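(* Let $f\colon M^n(0)\to\mathbb{R}^{2n}$ be a Lagrangian isometric immersion of a flat Riemannian manifold with index of relative nullity $\nu_f\equiv0$. Then any $P$-transform $\tilde f=\mathcal{R}_{\varphi,\beta,\Omega,P}(f)\colon\tilde M^n(0)\to\mathbb{R}^{2n}$ of $f$ is also Lagrangian.
   Context: $\mathbb{R}^{2n}\cong\mathbb{C}^n$ with complex structure $J$. An isometric immersion $f\colon M^n\to\mathbb{C}^n$ is Lagrangian if $J$ carries each tangent space of $M^n$ onto the corresponding normal space. $\nu_f(x)$ is the dimension of the kernel of the second fundamental form of $f$ at $x$. $N_fM$, $\nabla^\perp$, $\alpha$, $A_\xi$ denote the normal bundle, normal connection, second fundamental form and shape operators of $f$. The superscript $t$ denotes transpose. Vectorial Ribaucour transform. Let $V$ be a (finite-dimensional) Euclidean vector space, identified with the trivial bundle $M\times V$ with its flat connection; $V^*\otimes V$ is identified with the endomorphisms of $V$. Let $\varphi\colon M\to V$ be smooth, $\omega=d\varphi$, $\langle\omega^t(v),X\rangle=\langle v,\omega(X)\rangle$, and let $\beta\in\Gamma(V^*\otimes N_fM)$ satisfy $\alpha(X,\omega^t(v))+(\nabla_X\beta)v=0$ (with $(\nabla_X\beta)v=\nabla^\perp_X(\beta(v))-\beta(\nabla_Xv)$) and $[\Phi_u,\Phi_v]=0$ for all $X,u,v$, where $\Phi_vX=\Phi(X)(v)=(\nabla_X\omega^t)v-A_{\beta(v)}X$. Put $\mathcal{F}=f_*\omega^t+\beta$ and let $\Omega\in\Gamma(V^*\otimes V)$ be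 everywhere invertible with $d\Omega=\mathcal{F}^td\mathcal{F}$ and $\Omega+\Omega^t=\mathcal{F}^t\mathcal{F}$. Then $\tilde f=\mathcal{R}_{\varphi,\beta,\Omega}(f)=f-\mathcal{F}\Omega^{-1}\varphi$, defined on the set $\tilde M^n$ of its regular points with the induced metric, is the vectorial Ribaucour transform of $f$ determined by $(\varphi,\beta,\Omega)$. $P$-transform. For $f$ Lagrangian with flat $M^n(0)$, $\tilde f=\mathcal{R}_{\varphi,\beta,\Omega}(f)$ is a $P$-transform of $f$, written $\mathcal{R}_{\varphi,\beta,\Omega,P}(f)$, if there is $P\in V^*\otimes V$ with $\sigma(P)\cap(-\sigma(P))=\emptyset$ ($\sigma(P)$ the set of complex eigenvalues of $P$) such that $\beta=Jf_*\omega^tP$ and $\Omega^tP+P^t\Omega^t+T\rho=0$, where $T=-P^t-(P^t)^{-1}$ and $\rho=P^t\omega\omega^tP$. *)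

(* Defs.v *)
From HB Require Import structures.
From mathcomp Require Import all_boot all_order all_algebra.
From mathcomp Require Import all_classical all_reals all_analysis.
From mathcomp Require Import complex.

Set Implicit Arguments.
Unset Strict Implicit.
Unset Printing Implicit Defensive.

Import Order.TTheory GRing.Theory Num.Theory.
Import numFieldNormedType.Exports.

Local Open Scope classical_set_scope.
Local Open Scope ring_scope.

(* Vectors are columns throughout: a matrix A : 'M_(m, n) is the linear map
   u |-> A *m u from R^n to R^m, and its transpose is the adjoint for the
   standard inner products. *)

Section Smooth.
Context {R : realType} {n m d : nat}.

Fixpoint iter_derive (vs : seq 'cV[R]_n) (h : 'cV[R]_n -> 'M[R]_(m, d)) :
    'cV[R]_n -> 'M[R]_(m, d) :=
  if vs is v :: vs' then fun y => 'D_v (iter_derive vs' h) y else h.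

(* For U open this is C^oo on U: all iterated directional derivatives exist
   and are Frechet differentiable, hence continuous. *)
Definition smooth_on (U : set 'cV[R]_n) (h : 'cV[R]_n -> 'M[R]_(m, d)) : Prop :=
  forall vs y, U y -> differentiable (iter_derive vs h) y.

End Smooth.

(* A smooth manifold of dimension n, given by a smooth atlas: coord i is the
   chart with domain cdom i, and param i is its inverse on the image of the
   chart; neither is constrained elsewhere. *)
Record smooth_manifold (R : realType) (n : nat) := SmoothManifold {
  mfd_space :> topologicalType;
  mfd_hausdorff : hausdorff_space mfd_space;
  mfd_second_countable : @second_countable mfd_space;
  chart : Type;
  cdom : chart -> set mfd_space;
  coord : chart -> mfd_space -> 'cV[R]_n;
  param : chart -> 'cV[R]_n -> mfd_space;
  cdom_cover : forall x, exists i, cdom i x;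
  cdom_open : forall i, open (cdom i);
  cimg_open : forall i, open (coord i @` cdom i);
  coordK : forall i x, cdom i x -> param i (coord i x) = x;
  coord_continuous : forall i, {within cdom i, continuous (coord i)};
  param_continuous :
    forall i, {within coord i @` cdom i, continuous (param i)};
  transition_smooth : forall i j,
    smooth_on (coord i @` (cdom i `&` cdom j)) (coord j \o param i)
}.
Arguments cdom {R n s} i _.
Arguments coord {R n s} i _.
Arguments param {R n s} i _.

Section ManifoldCalculus.
Context {R : realType} {n : nat} {M : smooth_manifold R n}.
Implicit Types (i : chart M) (x : M) (X Y Z : 'cV[R]_n).

Definition smooth_map m d (h : M -> 'M[R]_(m, d)) : Prop :=
  forall i, smooth_on (coord i @` cdom i) (h \o param i).

(* A tangent vector at x, x in cdom i, is represented by its components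
   X : 'cV_n in the chart i. A fixed X also stands for the vector field with
   constant components X in the chart i; every tensorial identity below may be
   tested on such fields. *)
Definition dd i m d (h : M -> 'M[R]_(m, d)) x X : 'M[R]_(m, d) :=
  'D_X (h \o param i) (coord i x).

Definition e_ (k : 'I_n) : 'cV[R]_n := delta_mx k ord0.

Definition diff_mx i m (h : M -> 'cV[R]_m) x : 'M[R]_(m, n) :=
  \matrix_(a < m, k < n) dd i h x (e_ k) a ord0.

Definition form (G : 'M[R]_n) X Y : R := (X^T *m G *m Y) ord0 ord0.

(* A metric is given by its Gram matrices in the charts: g i x a b is the
   inner product of the a-th and b-th coordinate vectors of the chart i at x. *)
Record riemannian_metric (g : chart M -> M -> 'M[R]_n) : Prop := {
  metric_smooth : forall i, smooth_on (coord i @` cdom i) (g i \o param i);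
  metric_sym : forall i x, cdom i x -> (g i x)^T = g i x;
  metric_pos : forall i x X, cdom i x -> X != 0 -> 0 < form (g i x) X X;
  metric_change : forall i j x, cdom i x -> cdom j x ->
    g i x = (diff_mx i (coord j) x)^T *m g j x *m diff_mx i (coord j) x
}.

Section LeviCivita.
Variable g : chart M -> M -> 'M[R]_n.

(* Koszul formula for fields with constant components, whose brackets
   vanish. *)
Definition christoffel i x X Y : 'cV[R]_n :=
  2^-1 *: (invmx (g i x) *m
    \col_(k < n) (form (dd i (g i) x X) Y (e_ k)
                  + form (dd i (g i) x Y) X (e_ k)
                  - form (dd i (g i) x (e_ k)) X Y)).

Definition nabla i (Z : M -> 'cV[R]_n) x X : 'cV[R]_n :=
  dd i Z x X + christoffel i x X (Z x).

(* There is no bracket term: X and Y have constant components. *)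
Definition curvature i x X Y Z : 'cV[R]_n :=
  nabla i (fun p => nabla i (fun=> Z) p Y) x X
  - nabla i (fun p => nabla i (fun=> Z) p X) x Y.

Definition flat_on (S : set M) : Prop :=
  forall i x X Y Z, cdom i x -> S x -> curvature i x X Y Z = 0.

End LeviCivita.

Section Immersions.
Context {m : nat}.
Variable f : M -> 'cV[R]_m.
Implicit Types (xi w : 'cV[R]_m).

Definition dot w xi : R := (w^T *m xi) ord0 ord0.

Definition induced_metric i x : 'M[R]_n := (diff_mx i f x)^T *m diff_mx i f x.

Definition regular_points : set M :=
  [set x | forall i, cdom i x -> \rank (diff_mx i f x) = n].

Definition isometric_immersion (g : chart M -> M -> 'M[R]_n) : Prop :=
  [/\ smooth_map f,
      forall x, regular_points x &
      forall i x X Y, cdom i x ->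
        dot (dd i f x X) (dd i f x Y) = form (g i x) X Y].

Definition tangent_space i x : set 'cV[R]_m := range (dd i f x).

Definition normal_space i x : set 'cV[R]_m :=
  [set xi | forall w, tangent_space i x w -> dot w xi = 0].

(* Orthogonal projection onto the normal space, at regular points. *)
Definition normal_part i x w : 'cV[R]_m :=
  w - diff_mx i f x *m invmx (induced_metric i x) *m (diff_mx i f x)^T *m w.

Definition normal_nabla i (xi : M -> 'cV[R]_m) x X : 'cV[R]_m :=
  normal_part i x (dd i xi x X).

Definition second_form i x X Y : 'cV[R]_m :=
  normal_part i x (dd i (fun p => dd i f p Y) x X).

(* The vector A_xi X characterized by <A_xi X, Y> = <alpha(X, Y), xi>. *)
Definition shape_op i x xi X : 'cV[R]_n :=
  invmx (induced_metric i x) *m \col_(k < n) dot (second_form i x X (e_ k)) xi.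

(* The k-th row lists the components of all the alpha(e_k, e_l), so that the
   row kernel is the space of X^T such that alpha(X, Y) = 0 for all Y. *)
Definition second_form_mx i x : 'M[R]_(n, n * m) :=
  \matrix_(k < n) mxvec (\matrix_(l < n) (second_form i x (e_ k) (e_ l))^T).

Definition relative_nullity i x : nat := \rank (kermx (second_form_mx i x)).

End Immersions.

(* Multiplication by the imaginary unit on C^n = R^n x R^n:
   (a, b) |-> (- b, a). *)
Definition Jmx : 'M[R]_(n + n) := block_mx 0 (- 1%:M) 1%:M 0.

Definition lagrangian_on (S : set M) (f : M -> 'cV[R]_(n + n)) : Prop :=
  forall i x, cdom i x -> S x ->
    [set Jmx *m w | w in tangent_space f i x] = normal_space f i x.

Section Ribaucour.
Context {m d : nat}.
Variables (g : chart M -> M -> 'M[R]_n) (f : M -> 'cV[R]_m).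
Variables (phi : M -> 'cV[R]_d) (beta : M -> 'M[R]_(m, d)).
Implicit Types (u v : 'cV[R]_d).

Definition omega i x : 'M[R]_(d, n) := diff_mx i phi x.

(* Adjoint of omega for the metric g x on the tangent space. *)
Definition omega_t i x : 'M[R]_(n, d) := invmx (g i x) *m (omega i x)^T.

(* The constant v is a parallel section of M x V, so the second term of
   (nabla_X beta) v = nabla^perp_X (beta v) - beta (nabla_X v) vanishes;
   likewise for (nabla_X omega^t) v in Phi_. *)
Definition nabla_beta i x X v : 'cV[R]_m :=
  normal_nabla f i (fun p => beta p *m v) x X.

Definition Phi_ i x v X : 'cV[R]_n :=
  nabla g i (fun p => omega_t i p *m v) x X - shape_op f i x (beta x *m v) X.

Definition calF i x : 'M[R]_(m, d) := diff_mx i f x *m omega_t i x + beta x.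

(* ft is the map f - F Omega^-1 phi on all of M; the transform itself is its
   restriction to regular_points ft. The matrix calF i x does not depend on
   the chart i around x, although its expression does. The Euclidean space V
   is R^d with its standard inner product. *)
Record vectorial_ribaucour (Omega : M -> 'M[R]_d) (ft : M -> 'cV[R]_m) :
    Prop := {
  vr_phi_smooth : smooth_map phi;
  vr_beta_smooth : smooth_map beta;
  vr_Omega_smooth : smooth_map Omega;
  vr_beta_normal : forall i x v, cdom i x -> normal_space f i x (beta x *m v);
  vr_beta_eq : forall i x X v, cdom i x ->
    second_form f i x X (omega_t i x *m v) + nabla_beta i x X v = 0;
  vr_Phi_comm : forall i x u v X, cdom i x ->
    Phi_ i x u (Phi_ i x v X) = Phi_ i x v (Phi_ i x u X);
  vr_Omega_unit : forall x, Omega x \in unitmx;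
  vr_Omega_diff : forall i x X, cdom i x ->
    dd i Omega x X = (calF i x)^T *m dd i (calF i) x X;
  vr_Omega_sym : forall i x, cdom i x ->
    Omega x + (Omega x)^T = (calF i x)^T *m calF i x;
  vr_transform : forall i x, cdom i x ->
    ft x = f x - calF i x *m invmx (Omega x) *m phi x
}.

End Ribaucour.

(* eigenvalue refers to row vectors, hence the transpose: z is in the spectrum
   iff P v = z v for some nonzero complex column v. *)
Definition spectrum d (P : 'M[R]_d) : set R[i] :=
  [set z | eigenvalue (map_mx (real_complex R) P)^T z].

Record P_transform d (g : chart M -> M -> 'M[R]_n) (f : M -> 'cV[R]_(n + n))
    (phi : M -> 'cV[R]_d) (beta : M -> 'M[R]_(n + n, d)) (Omega : M -> 'M[R]_d)
    (P : 'M[R]_d) (ft : M -> 'cV[R]_(n + n)) : Prop := {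
  pt_ribaucour : vectorial_ribaucour g f phi beta Omega ft;
  pt_spectrum : spectrum P `&` [set - z | z in spectrum P] = set0;
  pt_beta : forall i x, cdom i x ->
    beta x = Jmx *m diff_mx i f x *m omega_t g phi i x *m P;
  pt_Omega : forall i x, cdom i x ->
    let T := - P^T - invmx P^T in
    let rho := P^T *m omega phi i x *m omega_t g phi i x *m P in
    (Omega x)^T *m P + P^T *m (Omega x)^T + T *m rho = 0
}.

End ManifoldCalculus.

(* Main.v *)
Require Import Defs.
From HB Require Import structures.
From mathcomp Require Import all_boot all_order all_algebra.
From mathcomp Require Import all_classical all_reals all_analysis.
From mathcomp Require Import complex ring lra.

Set Implicit Arguments.
Unset Strict Implicit.
Unset Printing Implicit Defensive.

Import Order.TTheory GRing.Theory Num.Theory.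
Import numFieldNormedType.Exports.

Local Open Scope classical_set_scope.
Local Open Scope ring_scope.

(** Everything is local, so fix a chart and write A for the matrix of the
differential of f, G = A^T A for the metric, W for omega^t, P for the given
endomorphism, Q = P^-1, and F = A W + J A W P for calF. As f is Lagrangian, A
and J A together frame R^2n (lagrangian_frame), so the second derivatives of f
are described by matrices S_X, the cubic form of f, with normal part
J A S_X of D_X A. They are self-adjoint for G because A^T J A = 0 can be
differentiated, and by the Gauss equation flatness of f means exactly that
they commute.

Since beta = J f_* omega^t P, the equation linking alpha and nabla beta becomes
the first-order system nabla_X omega^t = - S_X omega^t Q. Hence
D_X F = - A S_X W (P + Q) is tangent to f, and so D_X Omega = F^T D_X F gives

  D_X ft = E (X + S_X W (P + Q) Omega^-1 phi),  E = A - F Omega^-1 omega.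

Thus ft is tangent to the planes spanned by E = (1 - F Omega^-1 F^T) A. The
equation Omega + Omega^t = F^t F says that 1 - F Omega^-1 F^T is orthogonal, so
E^T E = G, and the algebraic condition on Omega^t P says precisely that these
planes are isotropic, E^T J E = 0. Therefore ft is Lagrangian wherever it is an
immersion.

For flatness, differentiating E shows that the part of D_X E normal to E has
the form N S_X with N independent of X: the cubic form of E is a fixed matrix
times the one of f. The matrices N S_X are symmetric, again because
E^T J E = 0 can be differentiated, and the S_X are self-adjoint and commute;
hence the expressions (N S_X)^T G^-1 (N S_Y) are symmetric in X and Y
(gram_swap). For the immersion ft, whose differential is E times an invertible
matrix, this is exactly the vanishing of the right-hand side of the Gauss
equation (transform_gauss_sym), so its induced metric is flat.

The analytic ingredients are a differential calculus of matrix-valued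
functions, the stability of smoothness under the matrix operations, the
symmetry of second derivatives, and the Gauss equation for the curvature that
the Koszul formula defines. *)

(** * Differential calculus of matrix-valued functions *)

Lemma near_eq_differentiable (R : numFieldType) (V W : normedModType R)
    (f g : V -> W) (y : V) :
  {near y, f =1 g} -> differentiable f y -> differentiable g y.
Proof.
move=> fg df; have /diff_locallyP[dfc dfo] := df.
have gfy : g y = f y by rewrite (nbhs_singleton fg).
have dgo : g \o shift y = cst (g y) + 'd f y +o_ 0 id.
  apply/eqaddoP => _ /posnumP[e].
  have /eqaddoP/(_ e%:num)/(_ (gt0 _)) dfe := dfo.
  have fg0 : \forall h \near 0, f (h + y) = g (h + y).
    by move: fg; rewrite (near_shift 0) subr0.
  apply: filterS2 fg0 dfe => h; rewrite /= !fctE /= gfy => ->//.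
by apply/diff_locallyP; rewrite (diff_unique dfc dgo).
Qed.

Section MatrixCalculus.
Context {R : realType} {V : normedModType R}.
Implicit Types (v y : V).

Lemma differentiable_mxP m n (A : V -> 'M[R]_(m, n)) y :
  differentiable A y <-> forall i j, differentiable (fun z => A z i j) y.
Proof.
split=> [dA i j|dA].
  by apply: (@differentiable_comp _ _ _ _ A (fun N : 'M[R]_(m, n) => N i j)) => //;
     exact: differentiable_coord.
have -> : A = \sum_(i < m) (\sum_(j < n) (fun z => A z i j *: delta_mx i j)).
  apply/funext => z; rewrite fct_sumE [LHS]matrix_sum_delta.
  by apply: eq_bigr => i _; rewrite fct_sumE.
apply: differentiable_sum => i; apply: differentiable_sum => j.
exact: differentiableZl.
Qed.

Lemma derive_mxE m n (A : V -> 'M[R]_(m, n)) y v i j : differentiable A y ->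
  'D_v A y i j = 'D_v (fun z => A z i j) y.
Proof. by move=> dA; rewrite derive_mx ?mxE//; exact: diff_derivable. Qed.

Lemma differentiable_mulmx m n p (A : V -> 'M[R]_(m, n)) (B : V -> 'M[R]_(n, p))
    y : differentiable A y -> differentiable B y ->
  differentiable (fun z => A z *m B z) y.
Proof.
move=> /differentiable_mxP dA /differentiable_mxP dB.
apply/differentiable_mxP => i j.
under eq_fun do rewrite mxE.
rewrite (_ : (fun _ => _) = \sum_k ((fun z => A z i k) * (fun z => B z k j))).
  by apply: differentiable_sum => k; apply: differentiableM.
by apply/funext => z; rewrite fct_sumE.
Qed.

Lemma derive_mulmx m n p (A : V -> 'M[R]_(m, n)) (B : V -> 'M[R]_(n, p)) y v :
  differentiable A y -> differentiable B y ->
  'D_v (fun z => A z *m B z) y = 'D_v A y *m B y + A y *m 'D_v B y.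
Proof.
move=> dA dB; apply/matrixP => i j.
rewrite derive_mxE; last exact: differentiable_mulmx.
under eq_fun do rewrite mxE.
have dAe := (differentiable_mxP _ _).1 dA.
have dBe := (differentiable_mxP _ _).1 dB.
rewrite (_ : (fun _ => _) = \sum_k ((fun z => A z i k) * (fun z => B z k j)));
  last by apply/funext => z; rewrite fct_sumE.
rewrite derive_sum; last first.
  by move=> k; apply: derivableM; apply: diff_derivable.
rewrite !mxE -big_split; apply: eq_bigr => k _ /=.
rewrite deriveM; [|exact: diff_derivable..].
by rewrite !derive_mxE// addrC; congr (_ + _); exact: mulrC.
Qed.

Lemma derive_mulmxl p q r (C : 'M[R]_(p, q)) (B : V -> 'M[R]_(q, r)) y v :
  differentiable B y -> 'D_v (fun z => C *m B z) y = C *m 'D_v B y.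
Proof.
move=> dB; rewrite (derive_mulmx v (differentiable_cst C y) dB).
by rewrite (derive_cst C) mul0mx add0r.
Qed.

Lemma derive_mulmxr p q r (B : V -> 'M[R]_(p, q)) (C : 'M[R]_(q, r)) y v :
  differentiable B y -> 'D_v (fun z => B z *m C) y = 'D_v B y *m C.
Proof.
move=> dB; rewrite (derive_mulmx v dB (differentiable_cst C y)).
by rewrite (derive_cst C) mulmx0 addr0.
Qed.

Lemma differentiable_trmx m n (A : V -> 'M[R]_(m, n)) y :
  differentiable A y -> differentiable (fun z => (A z)^T) y.
Proof.
move=> /differentiable_mxP dA; apply/differentiable_mxP => i j.
by under eq_fun do rewrite mxE.
Qed.

Lemma derive_trmx m n (A : V -> 'M[R]_(m, n)) y v : differentiable A y ->
  'D_v (fun z => (A z)^T) y = ('D_v A y)^T.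
Proof.
move=> dA; apply/matrixP => i j.
rewrite derive_mxE; last exact: differentiable_trmx.
by under eq_fun do rewrite mxE; rewrite [RHS]mxE derive_mxE.
Qed.

Lemma differentiable_bigsum I (r : seq I) (f : I -> V -> R) y :
  (forall i, differentiable (f i) y) ->
  differentiable (fun z => \sum_(i <- r) f i z) y.
Proof.
move=> df; elim: r => [|i r IHr].
  by under eq_fun do rewrite big_nil; exact: differentiable_cst.
by under eq_fun do rewrite big_cons; exact: differentiableD.
Qed.

Lemma differentiable_bigprod I (r : seq I) (f : I -> V -> R) y :
  (forall i, differentiable (f i) y) ->
  differentiable (fun z => \prod_(i <- r) f i z) y.
Proof.
move=> df; elim: r => [|i r IHr].
  by under eq_fun do rewrite big_nil; exact: differentiable_cst.
by under eq_fun do rewrite big_cons; exact: differentiableM.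
Qed.

Lemma differentiable_det n (A : V -> 'M[R]_n) y :
  differentiable A y -> differentiable (fun z => \det (A z)) y.
Proof.
move=> /differentiable_mxP dA; apply: differentiable_bigsum => s.
apply: (@differentiableM _ _ (cst _)); first exact: differentiable_cst.
exact: differentiable_bigprod.
Qed.

Lemma near_unitmx n (A : V -> 'M[R]_n) y : A y \in unitmx ->
  differentiable A y -> \forall z \near y, A z \in unitmx.
Proof.
rewrite unitmxE unitfE => uA /differentiable_det/differentiable_continuous.
move=> /(_ [set t | t != 0]) detA.
have {}detA : nbhs y [set z | \det (A z) != 0].
  by apply: detA; apply: open_nbhs_nbhs; split => //; exact: open_neq.
by apply: (filterS _ detA) => z; rewrite /= unitmxE unitfE.
Qed.

(** Cramer's rule: near y the inverse is the adjugate divided by the determinant. *)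
Lemma differentiable_invmx n (A : V -> 'M[R]_n) y : A y \in unitmx ->
  differentiable A y -> differentiable (fun z => invmx (A z)) y.
Proof.
move=> uA dA.
have dcof i j : differentiable (fun z => cofactor (A z) i j) y.
  apply: (@differentiableM _ _ (cst _)); first exact: differentiable_cst.
  apply: differentiable_det; apply/differentiable_mxP => a b.
  by under eq_fun do rewrite !mxE; exact: (differentiable_mxP _ _).1.
have dI : differentiable (fun z => (\det (A z))^-1 *: \adj (A z)) y.
  apply/differentiable_mxP => i j; under eq_fun do rewrite !mxE.
  apply: (@differentiableM _ _ (fun z => (\det (A z))^-1)) => //.
  by apply: differentiableV; [exact: differentiable_det|rewrite -unitfE].
apply: near_eq_differentiable dI.
by apply: filterS (near_unitmx uA dA) => z uz; rewrite /invmx uz.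
Qed.

Lemma derive_invmx n (A : V -> 'M[R]_n) y v : A y \in unitmx ->
  differentiable A y ->
  'D_v (fun z => invmx (A z)) y = - (invmx (A y) *m 'D_v A y *m invmx (A y)).
Proof.
move=> uA dA; have dI := differentiable_invmx uA dA.
have : 'D_v (fun z => invmx (A z) *m A z) y = 0.
  rewrite (near_eq_derive _ (g := cst 1%:M)) ?derive_cst//.
  by apply: filterS (near_unitmx uA dA) => z uz; rewrite mulVmx.
rewrite derive_mulmx// => /eqP; rewrite addr_eq0 => /eqP h.
by rewrite -[LHS]mulmx1 -(mulmxV uA) mulmxA h mulNmx.
Qed.

End MatrixCalculus.

(** * Smooth matrix-valued functions *)

Section SmoothFunctions.
Context {R : realType} {n : nat}.
Implicit Types (U O : set 'cV[R]_n) (v y : 'cV[R]_n).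

(** The iterated derivatives of a product are unwieldy, so stability of
smooth_on under products is proved by induction on the order k; Ck k is the
notion of order k for which this induction is structural. *)
Fixpoint Ck m d (k : nat) U (h : 'cV[R]_n -> 'M[R]_(m, d)) : Prop :=
  (forall y, U y -> differentiable h y) /\
  (if k is k'.+1 then forall v, Ck k' U ('D_v h) else True).

Lemma iter_derive_rcons m d vs v (h : 'cV[R]_n -> 'M[R]_(m, d)) :
  iter_derive (rcons vs v) h = iter_derive vs ('D_v h).
Proof. by elim: vs => //= w vs ->. Qed.

(** The derivative added is the innermost one, whence iter_derive_rcons. *)
Lemma smooth_on_derive m d U (h : 'cV[R]_n -> 'M[R]_(m, d)) v :
  smooth_on U h -> smooth_on U ('D_v h).
Proof. by move=> sh vs y Uy; rewrite -iter_derive_rcons; exact: sh. Qed.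

Lemma smooth_on_differentiable m d U (h : 'cV[R]_n -> 'M[R]_(m, d)) y :
  smooth_on U h -> U y -> differentiable h y.
Proof. by move=> /(_ [::] y). Qed.

Lemma smooth_onP m d U (h : 'cV[R]_n -> 'M[R]_(m, d)) :
  smooth_on U h <-> forall k, Ck k U h.
Proof.
split=> [sh k|Ch].
  elim: k h sh => [|k IHk] h sh; (split; first exact: (sh [::])).
    exact: I.
  by move=> v; apply/IHk/smooth_on_derive.
move=> vs; elim/last_ind: vs h Ch => [|vs v IHvs] h Ch y Uy.
  exact: (Ch 0%N).1.
by rewrite iter_derive_rcons; apply: IHvs => // k; exact: (Ch k.+1).2.
Qed.

Lemma Ck_pred m d k U (h : 'cV[R]_n -> 'M[R]_(m, d)) : Ck k.+1 U h -> Ck k U h.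
Proof.
elim: k h => [|k IHk] h [dh Dh]; (split; first exact: dh).
  exact: I.
by move=> v; apply: IHk; exact: Dh.
Qed.

Lemma smooth_on_sub m d U O (h : 'cV[R]_n -> 'M[R]_(m, d)) :
  O `<=` U -> smooth_on U h -> smooth_on O h.
Proof. by move=> OU sh vs y /OU; exact: sh. Qed.

(** Derivatives only see germs: this is what lets formulas valid on an open
set be differentiated there. *)
Lemma derive_germ m d O (h h' : 'cV[R]_n -> 'M[R]_(m, d)) v y :
  open O -> {in O, h =1 h'} -> O y -> 'D_v h y = 'D_v h' y.
Proof.
move=> oO hh' Oy; apply: near_eq_derive.
have : \forall z \near y, O z by exact: open_nbhs_nbhs.
by apply: filterS => z Oz; apply: hh'; rewrite inE.
Qed.

Lemma differentiable_germ m d O (h h' : 'cV[R]_n -> 'M[R]_(m, d)) y :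
  open O -> {in O, h =1 h'} -> O y -> differentiable h y -> differentiable h' y.
Proof.
move=> oO hh' Oy; apply: near_eq_differentiable.
have : \forall z \near y, O z by exact: open_nbhs_nbhs.
by apply: filterS => z Oz; apply: hh'; rewrite inE.
Qed.

Section OpenSet.
Variable O : set 'cV[R]_n.
Hypothesis oO : open O.

Lemma Ck_germ m d k (h h' : 'cV[R]_n -> 'M[R]_(m, d)) :
  {in O, h =1 h'} -> Ck k O h -> Ck k O h'.
Proof.
elim: k h h' => [|k IHk] h h' hh' [dh Dh]; (split;
  first by move=> y Oy; apply: (differentiable_germ oO hh' Oy); exact: dh).
  exact: I.
move=> v; apply: IHk (Dh v) => y; rewrite inE => Oy.
exact: (derive_germ v oO hh' Oy).
Qed.

Lemma CkD m d k (h h' : 'cV[R]_n -> 'M[R]_(m, d)) :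
  Ck k O h -> Ck k O h' -> Ck k O (fun y => h y + h' y).
Proof.
elim: k h h' => [|k IHk] h h' [dh Dh] [dh' Dh']; (split;
  first by move=> y Oy; apply: differentiableD; [exact: dh|exact: dh']).
  exact: I.
move=> v; apply: Ck_germ (IHk _ _ (Dh v) (Dh' v)) => y; rewrite inE => Oy.
rewrite deriveD//; first exact/diff_derivable/dh.
exact/diff_derivable/dh'.
Qed.

Lemma CkM m p d k (h : 'cV[R]_n -> 'M[R]_(m, p)) (h' : 'cV[R]_n -> 'M[R]_(p, d)) :
  Ck k O h -> Ck k O h' -> Ck k O (fun y => h y *m h' y).
Proof.
elim: k h h' => [|k IHk] h h' Ch Ch'; have [dh Dh] := Ch; have [dh' Dh'] := Ch'.
  split; last exact: I.
  by move=> y Oy; apply: differentiable_mulmx; [exact: dh|exact: dh'].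
split=> [y Oy|v].
  by apply: differentiable_mulmx; [exact: dh|exact: dh'].
apply: Ck_germ (CkD (IHk _ _ (Dh v) (Ck_pred Ch')) (IHk _ _ (Ck_pred Ch) (Dh' v))).
by move=> y; rewrite inE => Oy; rewrite derive_mulmx; [|exact: dh|exact: dh'].
Qed.

Lemma Ck_cst m d k (C : 'M[R]_(m, d)) : Ck k O (fun=> C).
Proof.
elim: k C => [|k IHk] C;
  (split; first by move=> y _; exact: differentiable_cst).
  exact: I.
move=> v; apply: Ck_germ (IHk 0) => y _; by rewrite (derive_cst C).
Qed.

Lemma Ck_trmx m d k (h : 'cV[R]_n -> 'M[R]_(m, d)) :
  Ck k O h -> Ck k O (fun y => (h y)^T).
Proof.
elim: k h => [|k IHk] h [dh Dh];
  (split; first by move=> y Oy; apply: differentiable_trmx; exact: dh).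
  exact: I.
move=> v; apply: Ck_germ (IHk _ (Dh v)) => y; rewrite inE => Oy.
by rewrite derive_trmx; [|exact: dh].
Qed.

(** The induction closes because the derivative of an inverse,
- A^-1 A' A^-1, is a product of functions of order k. *)
Lemma Ck_invmx d k (h : 'cV[R]_n -> 'M[R]_d) :
  (forall y, O y -> h y \in unitmx) ->
  Ck k O h -> Ck k O (fun y => invmx (h y)).
Proof.
move=> uh; elim: k => [|k IHk] Ch; have [dh Dh] := Ch.
  split; last exact: I.
  by move=> y Oy; apply: differentiable_invmx; [exact: uh|exact: dh].
split=> [y Oy|v]; first by apply: differentiable_invmx; [exact: uh|exact: dh].
have Ci := IHk (Ck_pred Ch).
apply: Ck_germ (CkM (Ck_cst k (- 1%:M)) (CkM (CkM Ci (Dh v)) Ci)) => y.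
rewrite inE => Oy; rewrite derive_invmx; [|exact: uh|exact: dh].
by rewrite mulNmx mul1mx.
Qed.

Lemma smooth_on_germ m d (h h' : 'cV[R]_n -> 'M[R]_(m, d)) :
  {in O, h =1 h'} -> smooth_on O h -> smooth_on O h'.
Proof. by move=> hh' /smooth_onP sh; apply/smooth_onP => k; exact: Ck_germ (sh k). Qed.

Lemma smooth_on_cst m d (C : 'M[R]_(m, d)) : smooth_on O (fun=> C).
Proof. by apply/smooth_onP => k; exact: Ck_cst. Qed.

Lemma smooth_on_add m d (h h' : 'cV[R]_n -> 'M[R]_(m, d)) :
  smooth_on O h -> smooth_on O h' -> smooth_on O (fun y => h y + h' y).
Proof. by move=> /smooth_onP sh /smooth_onP sh'; apply/smooth_onP => k; exact: CkD. Qed.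

Lemma smooth_on_mulmx m p d (h : 'cV[R]_n -> 'M[R]_(m, p))
    (h' : 'cV[R]_n -> 'M[R]_(p, d)) :
  smooth_on O h -> smooth_on O h' -> smooth_on O (fun y => h y *m h' y).
Proof. by move=> /smooth_onP sh /smooth_onP sh'; apply/smooth_onP => k; exact: CkM. Qed.

Lemma smooth_on_opp m d (h : 'cV[R]_n -> 'M[R]_(m, d)) :
  smooth_on O h -> smooth_on O (fun y => - h y).
Proof.
move=> sh; apply: smooth_on_germ (smooth_on_mulmx (smooth_on_cst (- 1%:M)) sh).
by move=> y _; rewrite mulNmx mul1mx.
Qed.

Lemma smooth_on_trmx m d (h : 'cV[R]_n -> 'M[R]_(m, d)) :
  smooth_on O h -> smooth_on O (fun y => (h y)^T).
Proof. by move=> /smooth_onP sh; apply/smooth_onP => k; exact: Ck_trmx. Qed.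

Lemma smooth_on_invmx d (h : 'cV[R]_n -> 'M[R]_d) :
  (forall y, O y -> h y \in unitmx) ->
  smooth_on O h -> smooth_on O (fun y => invmx (h y)).
Proof. by move=> uh /smooth_onP sh; apply/smooth_onP => k; exact: Ck_invmx. Qed.

End OpenSet.
End SmoothFunctions.

(** * Symmetry of second derivatives *)

Section Schwarz.
Context {R : realType} {V : normedModType R}.
Implicit Types (f : V -> R) (O : set V) (u v y z : V).

(** Both difference quotients are the same function of the increment. *)
Lemma is_derive_line f z u (s : R) : derivable f (s *: u + z) u ->
  is_derive s 1 (fun t => f (t *: u + z)) ('D_u f (s *: u + z)).
Proof.
have quotE : (fun h : R => h^-1 *: (f ((h *: 1 + s) *: u + z) - f (s *: u + z)))
    = (fun h => h^-1 *: (f (h *: u + (s *: u + z)) - f (s *: u + z))).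
  apply/funext => h; congr (_ *: (f _ - _)).
  by rewrite scalerDl -addrA /GRing.scale/= mulr1.
by rewrite /derivable -quotE => df; apply: DeriveDef => //; rewrite /derive quotE.
Qed.

(** The classical second difference over a small parallelogram, which is
symmetric in its two sides. *)
Definition second_difference f y u v (t : R) : R :=
  f (t *: u + (t *: v + y)) - f (t *: u + y) - f (t *: v + y) + f y.

(** By the mean value theorem along u, the second difference is t times an
increment of D_u f between two points that differ by t v; differentiability of
D_u f at the single point y then gives its value up to o(t^2). *)
Lemma second_difference_approx f O y u v (e : R) : open O -> O y ->
  (forall z, O z -> differentiable f z) -> differentiable ('D_u f) y -> 0 < e ->
  exists2 r : R, 0 < r & forall t, 0 < t < r ->
    `|second_difference f y u v t - t ^+ 2 * 'D_v ('D_u f) y| <= e * t ^+ 2.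
Proof.
move=> oO Oy df dg e0.
(* t C bounds the sum of the norms of the two displacements from y that occur
   below; the summand 1 makes C positive. *)
pose C := `|u| + `|u| + `|v| + 1.
have C0 : 0 < C by rewrite ltr_wpDl// !addr_ge0.
have [dgc dgo] := (diff_locallyP _ _).1 dg.
have eC0 : 0 < e / C by rewrite divr_gt0.
have /eqaddoP/(_ _ eC0) near_g := dgo.
have near_O : \forall w \near (0 : V), O (w + y).
  have : \forall z \near y, O z by exact: open_nbhs_nbhs.
  by rewrite (near_shift 0) subr0.
have /nbhs_normP[r /= r0 near_r] : \forall w \near (0 : V), O (w + y) /\
    `|'D_u f (w + y) - 'D_u f y - 'd ('D_u f) y w| <= e / C * `|w|.
  near=> w; split; first by near: w.
  have : `|('D_u f \o shift y - (cst ('D_u f y) + 'd ('D_u f) y)) w|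
    <= e / C * `|w| by near: w.
  by rewrite !fctE /= opprD addrA.
have {}near_r w : `|w| < r -> O (w + y) /\
    `|'D_u f (w + y) - 'D_u f y - 'd ('D_u f) y w| <= e / C * `|w|.
  by move=> wr; apply: near_r; rewrite /ball_/= sub0r normrN.
exists (r / C); first by rewrite divr_gt0.
move=> t /andP[t0]; rewrite ltr_pdivlMr// => tr.
have le_u s : 0 <= s <= t -> `|s *: u| <= t * `|u|.
  by move=> /andP[s0 st]; rewrite normrZ ger0_norm// ler_wpM2r.
have le_uv s : 0 <= s <= t -> `|s *: u + t *: v| <= t * (`|u| + `|v|).
  move=> st; rewrite mulrDr (le_trans (ler_normD _ _))// lerD// ?le_u//.
  by rewrite normrZ gtr0_norm.
have lt_u s : 0 <= s <= t -> `|s *: u| < r.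
  move=> /le_u/le_lt_trans; apply; apply: le_lt_trans tr.
  by rewrite ler_wpM2l ?(ltW t0)// /C -!addrA lerDl !addr_ge0.
have lt_uv s : 0 <= s <= t -> `|s *: u + t *: v| < r.
  move=> /le_uv/le_lt_trans; apply; apply: le_lt_trans tr.
  by rewrite ler_wpM2l ?(ltW t0)// /C -!addrA lerD2l ler_wpDl// lerDl.
pose F (s : R) := f (s *: u + (t *: v + y)) - f (s *: u + y).
pose dF (s : R) := 'D_u f (s *: u + (t *: v + y)) - 'D_u f (s *: u + y).
have derF s : 0 <= s <= t -> is_derive s 1 F (dF s).
  move=> st; apply: is_deriveB; apply: is_derive_line; apply: diff_derivable.
    by rewrite addrA; apply: df; exact: (near_r _ (lt_uv _ st)).1.
  by apply: df; exact: (near_r _ (lt_u _ st)).1.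
have [c] : exists2 c, c \in `]0, t[%R & F t - F 0 = dF c * (t - 0).
  apply: MVT => // [s|].
    by rewrite in_itv/= => /andP[s0 st]; apply: derF; rewrite !ltW.
  apply: continuous_in_subspaceT => s; rewrite inE/= in_itv/= => st.
  by apply/differentiable_continuous/derivable1_diffP; have [] := derF s st.
rewrite in_itv/= subr0 => /andP[c0 ct].
have -> : second_difference f y u v t = F t - F 0.
  by rewrite /F scale0r !add0r /second_difference; ring.
move=> ->.
have ct' : 0 <= c <= t by rewrite !ltW.
have [_ g1] := near_r _ (lt_uv _ ct'); have [_ g2] := near_r _ (lt_u _ ct').
rewrite (deriveE _ dg).
rewrite mulrC expr2 -mulrA -mulrBr normrM gtr0_norm// mulrCA ler_wpM2l ?(ltW t0)//.
set L := 'd _ _ in g1 g2 *.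
have -> : dF c - t * L v =
    ('D_u f (c *: u + t *: v + y) - 'D_u f y - L (c *: u + t *: v)) -
    ('D_u f (c *: u + y) - 'D_u f y - L (c *: u)).
  have -> : L (c *: u + t *: v) = L (c *: u) + t * L v.
    by rewrite linearD [L (t *: v)]linearZ.
  by rewrite /dF addrA; ring.
rewrite (le_trans (ler_normB _ _))//.
have -> : e * t = e / C * (t * C) by rewrite mulrCA divfK ?gt_eqF// mulrC.
apply: (le_trans (lerD g1 g2)); rewrite -mulrDr ler_wpM2l ?(ltW eC0)//.
apply: (le_trans (lerD (le_uv _ ct') (le_u _ ct'))).
rewrite -mulrDr ler_wpM2l ?(ltW t0)// /C.
lra.
Unshelve. all: by end_near. Qed.

(** The second difference approximates both mixed derivatives, one for
each order of its sides. *)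
Lemma schwarz_scalar f O y u v : open O -> O y ->
  (forall z, O z -> differentiable f z) ->
  differentiable ('D_u f) y -> differentiable ('D_v f) y ->
  'D_v ('D_u f) y = 'D_u ('D_v f) y.
Proof.
move=> oO Oy df du dv; apply/eqP; rewrite -subr_eq0 -normr_le0.
apply/ler_addgt0Pr => e e0; rewrite add0r.
have triangle (a b c x : R) : `|c - a| <= x -> `|c - b| <= x -> `|a - b| <= x + x.
  move=> ca cb; rewrite -(subrKA c a (- b)).
  apply: le_trans (ler_normD _ _) _; apply: lerD => //; by rewrite distrC.
have e20 : 0 < e / 2 by rewrite divr_gt0.
have [r r0 hr] := second_difference_approx v oO Oy df du e20.
have [q q0 hq] := second_difference_approx u oO Oy df dv e20.
pose t := Num.min r q / 2.
have t0 : 0 < t by rewrite divr_gt0// lt_min r0.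
have tm : t < Num.min r q by rewrite gtr_pMr ?lt_min ?r0// invf_lt1// ltr1n.
move: (tm); rewrite lt_min => /andP[tr tq].
have := hr t; rewrite t0 tr => /(_ isT) h1.
have := hq t; rewrite t0 tq => /(_ isT).
have -> : second_difference f y v u t = second_difference f y u v t.
  by rewrite /second_difference addrCA; congr (_ + _); rewrite addrAC.
move=> h2.
have t20 : 0 < t ^+ 2 by rewrite exprn_gt0.
rewrite -(ler_pM2l t20) -[X in X * `|_|](gtr0_norm t20) -normrM mulrBr.
rewrite [t ^+ 2 * e]mulrC (splitr e) mulrDl.
exact: triangle h1 h2.
Qed.

End Schwarz.

(** * Jacobian matrices *)

Section Jacobian.
Context {R : realType} {n m : nat}.
Variable O : set 'cV[R]_n.
Hypothesis oO : open O.
Implicit Types (h : 'cV[R]_n -> 'cV[R]_m) (y X Y : 'cV[R]_n).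

Lemma smooth_on_bigsum p q I (r : seq I) (h : I -> 'cV[R]_n -> 'M[R]_(p, q)) :
  (forall i, smooth_on O (h i)) ->
  smooth_on O (fun y => \sum_(i <- r) h i y).
Proof.
move=> sh; elim: r => [|i r IHr].
  by under eq_fun do rewrite big_nil; exact: smooth_on_cst.
by under eq_fun do rewrite big_cons; apply: smooth_on_add.
Qed.

(** Schwarz theorem, entry by entry. *)
Lemma schwarz p q (h : 'cV[R]_n -> 'M[R]_(p, q)) X Y y :
  smooth_on O h -> O y -> 'D_X ('D_Y h) y = 'D_Y ('D_X h) y.
Proof.
move=> sh Oy; apply/matrixP => i j.
have dh z : O z -> differentiable h z by exact: smooth_on_differentiable.
have dDh Z z : O z -> differentiable ('D_Z h) z.
  by apply: smooth_on_differentiable; exact: smooth_on_derive.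
have near_entry Z : {near y, (fun z => 'D_Z h z i j)
    =1 (fun z => 'D_Z (fun w => h w i j) z)}.
  have : \forall z \near y, O z by exact: open_nbhs_nbhs.
  by apply: filterS => z Oz; rewrite derive_mxE//; exact: dh.
have entry Z W : 'D_Z ('D_W h) y i j = 'D_Z ('D_W (fun w => h w i j)) y.
  by rewrite derive_mxE; [exact: near_eq_derive (near_entry W)|exact: dDh].
have dDe Z : differentiable ('D_Z (fun w => h w i j)) y.
  apply: near_eq_differentiable (near_entry Z) _.
  by have /differentiable_mxP := dDh Z _ Oy.
have de z : O z -> differentiable (fun w => h w i j) z.
  by move=> /dh/differentiable_mxP.
have comm := schwarz_scalar oO Oy de (dDe Y) (dDe X).
exact: (etrans (entry X Y) (etrans comm (esym (entry Y X)))).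
Qed.

Definition Jac h y : 'M[R]_(m, n) := \matrix_(a < m, k < n) 'D_(e_ k) h y a ord0.

Lemma mul_Jac h y X : differentiable h y -> Jac h y *m X = 'D_X h y.
Proof.
move=> dh; have {2}-> : X = \sum_k X k ord0 *: e_ k.
  by rewrite [LHS]matrix_sum_delta; apply: eq_bigr => k _; rewrite big_ord1.
rewrite deriveE// linear_sum; apply/matrixP => a b; rewrite !ord1 mxE summxE.
apply: eq_bigr => k _; rewrite linearZ !mxE mulrC deriveE//.
Qed.

(** The Jacobian matrix is a sum of products of partial derivatives with
constant covectors, so the closure properties of smoothness apply. *)
Lemma smooth_on_Jac h : smooth_on O h -> smooth_on O (Jac h).
Proof.
move=> sh; have -> : Jac h = fun y => \sum_k 'D_(e_ k) h y *m (e_ k)^T.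
  apply/funext => y; apply/matrixP => a k; rewrite mxE summxE (bigD1 k)//=.
  rewrite !mxE big_ord1 !mxE !eqxx mulr1 big1 ?addr0// => l lk.
  by rewrite !mxE big_ord1 !mxE eq_sym (negPf lk) mulr0.
apply: smooth_on_bigsum => k; apply: smooth_on_mulmx => //.
  exact: smooth_on_derive.
exact: smooth_on_cst.
Qed.

Lemma derive_Jac h y X Y : smooth_on O h -> O y ->
  'D_X (Jac h) y *m Y = 'D_X ('D_Y h) y.
Proof.
move=> sh Oy; have dJ := smooth_on_differentiable (smooth_on_Jac sh) Oy.
transitivity ('D_X (fun z => Jac h z *m Y) y).
  rewrite (derive_mulmx X dJ (differentiable_cst Y y)).
  by rewrite (derive_cst Y) mulmx0 addr0.
apply: (derive_germ _ oO) => // z; rewrite inE => Oz.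
by rewrite mul_Jac//; exact: smooth_on_differentiable sh _.
Qed.

(** This is the symmetry of second derivatives as it enters the geometry:
the vector D_X A * Y is the second derivative in the directions X and Y. *)
Lemma derive_Jac_sym h y X Y : smooth_on O h -> O y ->
  'D_X (Jac h) y *m Y = 'D_Y (Jac h) y *m X.
Proof.
move=> sh Oy; have comm := schwarz X Y sh Oy.
exact: etrans (derive_Jac X Y sh Oy) (etrans comm (esym (derive_Jac Y X sh Oy))).
Qed.

End Jacobian.

(** * The Gauss equation *)

Section Koszul.
Context {R : realType} {n m : nat}.
Implicit Types (X Y Z : 'cV[R]_n).

Lemma form_derive_gram (B a : 'M[R]_(m, n)) X Y :
  Defs.form (a^T *m B + B^T *m a) X Y =
  ((B *m Y)^T *m (a *m X)) ord0 ord0 + ((B *m X)^T *m (a *m Y)) ord0 ord0.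
Proof.
rewrite /Defs.form mulmxDr mulmxDl mxE; congr (_ + _); last first.
  by rewrite trmx_mul !mulmxA.
have trE (c : 'M[R]_1) : c ord0 ord0 = c^T ord0 ord0 by rewrite mxE.
by rewrite [RHS]trE !trmx_mul !trmxK !mulmxA.
Qed.

(** For a metric B^T B induced by a map with differential B and second
derivatives a, the symmetry of a makes all terms of the Koszul formula cancel
but two equal ones. *)
Lemma koszul_gram (B : 'M[R]_(m, n)) (a : 'cV[R]_n -> 'M[R]_(m, n))
    (dG : 'cV[R]_n -> 'M[R]_n) X Y :
  (forall Z W, a Z *m W = a W *m Z) ->
  (forall Z, dG Z = (a Z)^T *m B + B^T *m a Z) ->
  2^-1 *: \col_(k < n) (Defs.form (dG X) Y (e_ k) + Defs.form (dG Y) X (e_ k)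
                         - Defs.form (dG (e_ k)) X Y) = B^T *m (a X *m Y).
Proof.
move=> aC dGE; apply/matrixP => k j; rewrite [j]ord1 {j} mxE mxE.
have {1}-> : B^T = 1%:M *m B^T by rewrite mul1mx.
rewrite !dGE !form_derive_gram (aC X (e_ k)) (aC Y (e_ k)) (aC Y X).
have -> : (1%:M *m B^T *m (a X *m Y)) k ord0 =
    ((B *m e_ k)^T *m (a X *m Y)) ord0 ord0.
  by rewrite trmx_mul -!mulmxA mul1mx /e_ trmx_delta -rowE [RHS]mxE.
by field.
Qed.

End Koszul.

Section GaussEquation.
Context {R : realType} {n m : nat} {M : smooth_manifold R n}.
Variables (g : chart M -> M -> 'M[R]_n) (i : chart M) (O : set 'cV[R]_n).
Variable h : 'cV[R]_n -> 'cV[R]_m.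
Hypotheses (oO : open O) (Ochart : O `<=` Defs.coord i @` cdom i).
Hypothesis sh : smooth_on O h.
Let A := Jac h.
Let G y := (A y)^T *m A y.
Hypothesis gE : forall y, O y -> g i (param i y) = G y.
Hypothesis uG : forall y, O y -> G y \in unitmx.
Implicit Types (X Y Z : 'cV[R]_n).

Lemma cdom_param y : (Defs.coord i @` cdom i) y -> cdom i (param i y).
Proof. by move=> [x xi <-]; rewrite coordK. Qed.

Lemma coord_param y : (Defs.coord i @` cdom i) y -> Defs.coord i (param i y) = y.
Proof. by move=> [x xi <-]; rewrite coordK. Qed.

(** Converts derivatives of functions on the manifold into derivatives of
their expressions in the chart. *)
Lemma dd_germ p q (F : M -> 'M[R]_(p, q)) (F' : 'cV[R]_n -> 'M[R]_(p, q)) y X :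
  (forall z, O z -> F (param i z) = F' z) -> O y ->
  dd i F (param i y) X = 'D_X F' y.
Proof.
move=> FF' Oy; rewrite /dd coord_param; last exact: Ochart.
by apply: (derive_germ _ oO) => // z; rewrite inE => Oz; exact: FF'.
Qed.

Let sA : smooth_on O A. Proof. exact: smooth_on_Jac. Qed.
Let dA y : O y -> differentiable A y.
Proof. exact: smooth_on_differentiable. Qed.

(** The Levi-Civita connection of an induced metric is the tangential part
of the second derivative. *)
Lemma christoffel_induced y X Y : O y -> christoffel g i (param i y) X Y =
  invmx (G y) *m ((A y)^T *m ('D_X A y *m Y)).
Proof.
move=> Oy; rewrite /christoffel gE//.
have dg Z : dd i (g i) (param i y) Z =
    ('D_Z A y)^T *m A y + (A y)^T *m 'D_Z A y.
  rewrite (dd_germ _ gE Oy).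
  have dAy := dA Oy; have dAt := differentiable_trmx dAy.
  by rewrite (derive_mulmx Z dAt dAy) (derive_trmx Z dAy).
rewrite scalemxAr; congr (_ *m _).
apply: koszul_gram dg => Z W; exact: (derive_Jac_sym oO Z W sh Oy).
Qed.
Definition connection_mx X y := invmx (G y) *m ((A y)^T *m 'D_X A y).
(** The value of normal_mx X at Y is the second fundamental form at X, Y. *)
Definition normal_mx X y := 'D_X A y - A y *m connection_mx X y.

Let sDA X : smooth_on O ('D_X A). Proof. exact: smooth_on_derive. Qed.

Let sG : smooth_on O G.
Proof. by apply: smooth_on_mulmx => //; exact: smooth_on_trmx. Qed.

Let sGam X : smooth_on O (connection_mx X).
Proof.
apply: smooth_on_mulmx => //; first exact: smooth_on_invmx.
by apply: smooth_on_mulmx => //; exact: smooth_on_trmx.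
Qed.

Let sNor X : smooth_on O (normal_mx X).
Proof.
apply: smooth_on_add => //; apply: smooth_on_opp => //.
exact: smooth_on_mulmx.
Qed.

Lemma nabla_const y X Z : O y ->
  nabla g i (fun=> Z) (param i y) X = connection_mx X y *m Z.
Proof.
move=> Oy; rewrite /nabla christoffel_induced// /dd (derive_cst Z) add0r.
by rewrite /connection_mx !mulmxA.
Qed.

Lemma curvature_connection y X Y Z : O y ->
  curvature g i (param i y) X Y Z =
  ('D_X (connection_mx Y) y + connection_mx X y *m connection_mx Y y) *m Z -
  ('D_Y (connection_mx X) y + connection_mx Y y *m connection_mx X y) *m Z.
Proof.
have half U W : O y ->
    nabla g i (fun p => nabla g i (fun=> Z) p W) (param i y) U =
    ('D_U (connection_mx W) y + connection_mx U y *m connection_mx W y) *m Z.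
  move=> Oy; rewrite {1}/nabla christoffel_induced//.
  rewrite (nabla_const W Z Oy) mulmxDl; congr (_ + _); last first.
    by rewrite /connection_mx !mulmxA.
  rewrite (@dd_germ _ _ _ (fun z => connection_mx W z *m Z) y U _ Oy); last first.
    by move=> z; exact: nabla_const.
  have dGam := smooth_on_differentiable (sGam W) Oy.
  rewrite (derive_mulmx U dGam (differentiable_cst Z y)).
  by rewrite (derive_cst Z) mulmx0 addr0.
by move=> Oy; rewrite /curvature !half.
Qed.

Lemma tr_Jac_normal y X : O y -> (A y)^T *m normal_mx X y = 0.
Proof.
move=> Oy; rewrite mulmxBr /connection_mx 2!mulmxA -/(G y) mulmxV; last exact: uG.
by rewrite mul1mx subrr.
Qed.

(** Differentiating the tangency relation A^T N_Y = 0 trades the derivative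
of the normal part for the product of two normal parts, which is the content of
the Gauss equation. The remaining term is a third derivative of h, symmetric in
X and Y. *)
Lemma derive_connection y X Y : O y ->
  G y *m ('D_X (connection_mx Y) y + connection_mx X y *m connection_mx Y y) =
  (A y)^T *m 'D_X ('D_Y A) y + (normal_mx X y)^T *m normal_mx Y y.
Proof.
move=> Oy.
have dGam := smooth_on_differentiable (sGam Y) Oy.
have dNor := smooth_on_differentiable (sNor Y) Oy.
have dDA := smooth_on_differentiable (sDA Y) Oy.
have dAG := differentiable_mulmx (dA Oy) dGam.
have dN : 'D_X (normal_mx Y) y = 'D_X ('D_Y A) y -
    ('D_X A y *m connection_mx Y y + A y *m 'D_X (connection_mx Y) y).
  rewrite -(derive_mulmx X (dA Oy) dGam).
  exact: (deriveB (diff_derivable dDA) (diff_derivable dAG)).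
have tangency : ('D_X A y)^T *m normal_mx Y y +
    (A y)^T *m 'D_X (normal_mx Y) y = 0.
  rewrite -(derive_trmx X (dA Oy)).
  rewrite -(derive_mulmx X (differentiable_trmx (dA Oy)) dNor).
  rewrite -[RHS](derive_cst (0 : 'M[R]_n) y X).
  apply: (derive_germ _ oO) => // z; rewrite inE => Oz.
  exact: tr_Jac_normal.
(* Only the normal part of D_X A pairs with a normal vector. *)
have aX : 'D_X A y = normal_mx X y + A y *m connection_mx X y by rewrite subrK.
have GGam : (A y)^T *m 'D_X A y = G y *m connection_mx X y.
  by rewrite /connection_mx mulKVmx ?uG.
have NN : ('D_X A y)^T *m normal_mx Y y = (normal_mx X y)^T *m normal_mx Y y.
  have -> : ('D_X A y)^T =
      (normal_mx X y)^T + (connection_mx X y)^T *m (A y)^T.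
    by rewrite -trmx_mul -raddfD -aX.
  by rewrite mulmxDl -[X in _ + X]mulmxA tr_Jac_normal// mulmx0 addr0.
move: tangency; rewrite NN dN.
move: (normal_mx X y)^T (normal_mx Y y) ('D_X ('D_Y A) y) => NX NY aXY.
move: ('D_X (connection_mx Y) y) (connection_mx Y y) => dGamY GamY.
rewrite mulmxBr mulmxDr !mulmxA GGam -/(G y) addrA => /eqP; rewrite subr_eq0.
move=> /eqP tangency; rewrite mulmxDr mulmxA [RHS]addrC tangency.
exact: addrC.
Qed.

Lemma gauss_equation y X Y Z : O y ->
  G y *m curvature g i (param i y) X Y Z =
  ((normal_mx X y)^T *m normal_mx Y y - (normal_mx Y y)^T *m normal_mx X y)
  *m Z.
Proof.
have mul_diff (L a b c p q : 'M[R]_n) (k : 'cV[R]_n) : k = a *m Z - b *m Z ->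
    L *m a = c + p -> L *m b = c + q -> L *m k = (p - q) *m Z.
  move=> -> La Lb; rewrite mulmxBr !mulmxA La Lb -mulmxBl.
  by rewrite opprD addrACA subrr add0r.
move=> Oy; have comm := schwarz oO X Y sA Oy.
have dX := derive_connection X Y Oy; have dY := derive_connection Y X Oy.
apply: mul_diff (curvature_connection X Y Z Oy) dX _.
exact: etrans dY (congr1 (fun B => (A y)^T *m B + _) (esym comm)).
Qed.

End GaussEquation.

(** * Linear algebra of P-transforms *)

Section LagrangianPlanes.
Context {R : realType} {n : nat}.
Local Notation J := (@Jmx R n).

Lemma mul_JJ : J *m J = - 1%:M.
Proof.
rewrite mulmx_block !(mul0mx, mulmx0, mul1mx, mulmx1, add0r, addr0).
by rewrite (@scalar_mx_block _ n n) opp_block_mx oppr0.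
Qed.

Lemma tr_J : J^T = - J.
Proof.
rewrite /Jmx tr_block_mx opp_block_mx !trmx0 !oppr0 opprK.
by rewrite linearN/= trmx1.
Qed.

Lemma mulJJ p (B : 'M[R]_(n + n, p)) : J *m (J *m B) = - B.
Proof. by rewrite mulmxA mul_JJ mulNmx mul1mx. Qed.

(** The 2n columns of E and J E have the block diagonal Gram matrix with
blocks E^T E, hence form a square invertible matrix; its left inverse is also a
right inverse. *)
Lemma lagrangian_frame (E : 'M[R]_(n + n, n)) (Gi := invmx (E^T *m E)) :
  E^T *m E \in unitmx -> E^T *m J *m E = 0 ->
  E *m Gi *m E^T + (J *m E) *m Gi *m (J *m E)^T = 1%:M.
Proof.
move=> uG EJE.
have JEE : (J *m E)^T *m E = 0 by rewrite trmx_mul tr_J mulmxN mulNmx EJE oppr0.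
have EJE' : E^T *m (J *m E) = 0 by rewrite mulmxA.
have JEJE : (J *m E)^T *m (J *m E) = E^T *m E.
  by rewrite trmx_mul tr_J mulmxN mulNmx -mulmxA mulJJ mulmxN opprK.
have : col_mx (Gi *m E^T) (Gi *m (J *m E)^T) *m row_mx E (J *m E) = 1%:M.
  rewrite mul_col_row -!mulmxA JEE EJE' JEJE !mulmx0 mulVmx//.
  by rewrite (@scalar_mx_block _ n n).
by move/mulmx1C; rewrite mul_row_col !mulmxA.
Qed.

End LagrangianPlanes.

Section TransformAlgebra.
Context {R : realType} {n d : nat}.
Local Notation J := (@Jmx R n).
Variables (A : 'M[R]_(n + n, n)) (F : 'M[R]_(n + n, d)) (G : 'M[R]_n).
Variables (W : 'M[R]_(n, d)) (w : 'M[R]_(d, n)) (P Om : 'M[R]_d).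
Hypothesis GE : A^T *m A = G.
Hypothesis AJA : A^T *m J *m A = 0.
Hypothesis wE : W^T *m G = w.
Hypothesis FE : F = A *m W + J *m A *m W *m P.

Let AJA0 : A^T *m (J *m A) = 0. Proof. by rewrite mulmxA. Qed.

Let trF : F^T = W^T *m A^T - P^T *m (W^T *m (A^T *m J)).
Proof. by rewrite FE linearD/= !trmx_mul tr_J !(mulmxN, mulNmx) !mulmxA. Qed.

Lemma tr_calF_frame : F^T *m A = w.
Proof. by rewrite trF mulmxBl -!mulmxA AJA0 !mulmx0 subr0 GE. Qed.

Lemma tr_calF_J_frame : F^T *m (J *m A) = P^T *m w.
Proof.
by rewrite trF mulmxBl -!mulmxA AJA0 mulJJ !(mulmx0, mulmxN) sub0r opprK GE wE.
Qed.

Lemma tr_calF_calF : F^T *m F = w *m W + P^T *m (w *m (W *m P)).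
Proof.
rewrite {2}FE mulmxDr -!mulmxA [F^T *m (A *m _)]mulmxA tr_calF_frame.
by rewrite [J *m (A *m _)]mulmxA mulmxA tr_calF_J_frame -!mulmxA.
Qed.

Lemma tr_calF_J_calF : F^T *m (J *m F) = P^T *m (w *m W) - w *m (W *m P).
Proof.
rewrite {2}FE !mulmxDr -!mulmxA mulJJ mulmxN [F^T *m (A *m _)]mulmxA.
rewrite tr_calF_frame [J *m (A *m _)]mulmxA [F^T *m (_ *m W)]mulmxA.
by rewrite tr_calF_J_frame -!mulmxA.
Qed.

Lemma tr_frame_calF : A^T *m F = w^T.
Proof. by rewrite -tr_calF_frame trmx_mul trmxK. Qed.

Lemma tr_frame_J_calF : A^T *m (J *m F) = - (w^T *m P).
Proof.
rewrite -[P]trmxK -trmx_mul -tr_calF_J_frame !trmx_mul trmxK tr_J.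
by rewrite !(mulmxN, mulNmx) opprK mulmxA.
Qed.

Variable E : 'M[R]_(n + n, n).
Let Oi := invmx Om.
Hypothesis uOm : Om \in unitmx.
Hypothesis EE : E = A - F *m (Oi *m w).
Hypothesis OmS : Om + Om^T = F^T *m F.

Let trE : E^T = A^T - w^T *m (Oi^T *m F^T).
Proof. by rewrite EE linearB/= !trmx_mul !mulmxA. Qed.

Let trOiOm : Oi^T *m Om^T = 1%:M.
Proof. by rewrite -trmx_mul mulmxV// trmx1. Qed.

Let OmOi : Om *m Oi = 1%:M. Proof. exact: mulmxV. Qed.

(** As w = F^T A, the matrix E is (1 - F Om^-1 F^T) A, and the left factor is
orthogonal because the symmetric part of Om is F^T F / 2. *)
Lemma gram_rotated_frame : E^T *m E = G.
Proof.
(* This identity expresses that 1 - F Om^-1 F^T is orthogonal. *)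
have Oi_sym : Oi^T *m ((F^T *m F) *m Oi) = Oi^T + Oi.
  rewrite -OmS mulmxDl mulmxDr OmOi mulmx1.
  by rewrite mulmxA trOiOm mul1mx.
rewrite trE EE mulmxBl !mulmxBr GE -!mulmxA tr_calF_frame.
rewrite [A^T *m (F *m _)]mulmxA tr_frame_calF.
have -> : Oi^T *m (F^T *m (F *m (Oi *m w))) = Oi^T *m w + Oi *m w.
  by rewrite -mulmxDl -Oi_sym !mulmxA.
rewrite mulmxDr; move: (w^T *m (Oi *m w)) (w^T *m (Oi^T *m w)) => a b.
by apply/matrixP => k l; rewrite !mxE; ring.
Qed.

Hypothesis uP : P \in unitmx.
Hypothesis OmP :
  let T := - P^T - invmx P^T in
  let rho := P^T *m w *m W *m P in
  Om^T *m P + P^T *m Om^T + T *m rho = 0.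

(** The last condition in the definition of a P-transform, combined with the
formula for the symmetric part of Om, says that Om^T P - w W P is symmetric. *)
Lemma Omega_P_skew : P^T *m (w *m W) - w *m (W *m P) = P^T *m Om - Om^T *m P.
Proof.
have PiP : invmx P^T *m P^T = 1%:M by rewrite mulVmx// unitmx_tr.
have OmE : Om = w *m W + P^T *m (w *m (W *m P)) - Om^T.
  by rewrite -tr_calF_calF -OmS addrK.
move: OmP; rewrite /= mulmxBl mulNmx -!mulmxA [invmx _ *m (_ *m _)]mulmxA PiP.
rewrite mul1mx => /eqP; rewrite -addrA addr_eq0 => /eqP ->.
rewrite {1}OmE mulmxBr mulmxDr.
move: (P^T *m (w *m W)) (w *m (W *m P)) (P^T *m Om^T) (P^T *m (P^T *m _)).
by move=> a b c e; apply/matrixP => k l; rewrite !mxE; ring.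
Qed.

(** Expanding E^T J E leaves the defect of symmetry of Om^T P - w W P,
multiplied by w^T Om^-T on the left and by Om^-1 w on the right. *)
Lemma isotropic_rotated_frame : E^T *m J *m E = 0.
Proof.
rewrite -mulmxA trE EE mulmxBl !mulmxBr AJA0 -!mulmxA tr_calF_J_frame.
rewrite [J *m (F *m _)]mulmxA [A^T *m (_ *m _)]mulmxA tr_frame_J_calF.
have -> : Oi^T *m (F^T *m (J *m F *m (Oi *m w))) =
    Oi^T *m (P^T *m w) - P *m (Oi *m w).
  rewrite [F^T *m _]mulmxA tr_calF_J_calF Omega_P_skew mulmxBl mulmxBr.
  rewrite -!mulmxA [Om *m _]mulmxA OmOi mul1mx.
  by rewrite [Oi^T *m (Om^T *m _)]mulmxA trOiOm mul1mx.
rewrite mulmxBr mulNmx -!mulmxA.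
by apply/matrixP => k l; rewrite !mxE; ring.
Qed.

Section Derivative.
Variables (a : 'M[R]_(n + n, n)) (b : 'M[R]_(n + n, d)) (c : 'M[R]_(n, d)).
Let Gi := invmx G.
Let Q := invmx P.
Variables (S Gam : 'M[R]_n).
Hypothesis SE : G *m S = (J *m A)^T *m a.
Hypothesis GamE : G *m Gam = A^T *m a.
Hypothesis uG : G \in unitmx.
Hypothesis bE : b = a *m W + A *m c.
Hypothesis betaE : (J *m A)^T *m a *m W + A^T *m b *m P = 0.
Hypothesis GS : S^T *m G = G *m S.

Let JAA : (J *m A)^T *m A = 0.
Proof. by rewrite trmx_mul tr_J mulmxN mulNmx -mulmxA AJA0 oppr0. Qed.

Let frame p (B : 'M[R]_(n + n, p)) :
  B = A *m (Gi *m (A^T *m B)) + J *m (A *m (Gi *m ((J *m A)^T *m B))).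
Proof.
have := @lagrangian_frame _ _ A; rewrite GE => /(_ uG AJA) h.
by rewrite -{1}[B]mul1mx -h mulmxDl !mulmxA.
Qed.

(** The structure equation of a Lagrangian map: Gam is its connection matrix
and S its cubic form in the direction of the derivative a. *)
Lemma frame_structure : a = A *m Gam + J *m (A *m S).
Proof. by rewrite {1}[a]frame -SE -GamE !mulKmx. Qed.

(** The normal part of the derivative of A W is determined by the cubic form,
and its tangential part by the equation for beta. *)
Lemma tangent_variation : b = J *m (A *m (S *m W)) - A *m (S *m (W *m Q)).
Proof.
have JAb : (J *m A)^T *m b = (J *m A)^T *m a *m W.
  by rewrite bE mulmxDr !mulmxA JAA mul0mx addr0.
have Ab : A^T *m b = - ((J *m A)^T *m a *m (W *m Q)).
  move/eqP: betaE; rewrite addrC addr_eq0 => /eqP/(congr1 (mulmx^~ Q)).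
  by rewrite mulmxK// mulNmx !mulmxA.
by rewrite {1}[b]frame Ab JAb -SE -!(mulmxA G) mulmxN !mulKmx// mulmxN addrC.
Qed.

(** The two normal contributions cancel, so the derivative of calF is tangent
to f. *)
Lemma calF_variation : b + J *m b *m P = - (A *m (S *m (W *m (P + Q)))).
Proof.
rewrite tangent_variation mulmxBr mulJJ mulmxBl mulNmx !mulmxDr !mulmxA mulmxKV//.
by apply/matrixP => k l; rewrite !mxE; ring.
Qed.

Lemma omega_variation :
  b^T *m A + (A *m W)^T *m a = w *m Gam - Q^T *m (w *m S).
Proof.
have Abt : b^T *m A = - (Q^T *m (w *m S)).
  rewrite tangent_variation linearB/= mulmxBl !trmx_mul -!mulmxA tr_J.
  rewrite mulNmx mulmxN AJA0 oppr0 !mulmx0 sub0r GE; congr (- (_ *m _)).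
  by rewrite GS mulmxA wE.
by rewrite Abt trmx_mul -mulmxA -GamE mulmxA wE addrC.
Qed.

Let fX := - (A *m (S *m (W *m (P + Q)))).
Let omX := F^T *m fX.
Let wX := w *m Gam - Q^T *m (w *m S).

Let omXE : omX = - (w *m (S *m (W *m (P + Q)))).
Proof. by rewrite /omX /fX mulmxN [F^T *m _]mulmxA tr_calF_frame. Qed.

(** Here fX, omX and wX are the derivatives of calF, Om and omega, so the
left-hand side is the derivative of E by the product rule. Only the second term
on the right leaves the plane spanned by E, and it factors through S. *)
Lemma frame_variation :
  a - (fX *m (Oi *m w) + F *m (- (Oi *m omX *m Oi) *m w + Oi *m wX)) =
  E *m (Gam + S *m (W *m ((P + Q) *m (Oi *m w)))) +
  (J *m A + F *m (Oi *m (Q^T *m w))) *m S.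
Proof.
rewrite {1}frame_structure omXE /fX /wX EE.
rewrite !(mulmxDl, mulmxDr, mulmxN, mulNmx, mulmxA).
by apply/matrixP => k l; rewrite !mxE; ring.
Qed.

(** The left-hand side is the derivative of f - F Om^-1 phi in the direction
Y by the product rule. *)
Lemma transform_variation p (Y : 'M[R]_(n, p)) (phi : 'M[R]_(d, p)) :
  A *m Y - ((fX *m Oi + F *m - (Oi *m omX *m Oi)) *m phi + F *m Oi *m (w *m Y)) =
  E *m (Y + S *m (W *m ((P + Q) *m (Oi *m phi)))).
Proof.
rewrite omXE /fX EE.
rewrite !(mulmxDl, mulmxDr, mulmxN, mulNmx, mulmxA).
by apply/matrixP => k l; rewrite !mxE; ring.
Qed.

End Derivative.

End TransformAlgebra.

(** * Cubic forms of Lagrangian maps *)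

Section LagrangianMaps.
Context {R : realType} {n : nat}.
Local Notation J := (@Jmx R n).

(** N projects onto the plane spanned by J B, in which the normal part is
read off through the coefficients (J B)^T D. *)
Lemma lagrangian_normal_gram (B D1 D2 : 'M[R]_(n + n, n))
    (Gi := invmx (B^T *m B)) (N := fun D => D - B *m (Gi *m (B^T *m D))) :
  B^T *m B \in unitmx -> B^T *m J *m B = 0 ->
  (N D1)^T *m N D2 = ((J *m B)^T *m D1)^T *m (Gi *m ((J *m B)^T *m D2)).
Proof.
move=> uG BJB; have NE D : N D = (J *m B) *m (Gi *m ((J *m B)^T *m D)).
  have := lagrangian_frame uG BJB; rewrite -/Gi => /(congr1 (mulmx^~ D)).
  rewrite mul1mx mulmxDl -!mulmxA => frame.
  by rewrite /N -[X in X - _]frame addrC addKr.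
have GiT : Gi^T = Gi by rewrite /Gi trmx_inv trmx_mul trmxK.
have JBJB : (J *m B)^T *m (J *m B) = B^T *m B.
  by rewrite trmx_mul tr_J mulmxN mulNmx -mulmxA mulJJ mulmxN opprK.
rewrite !NE; move: JBJB; move: (J *m B) => C CC.
rewrite !trmx_mul trmxK GiT -!mulmxA [C^T *m (C *m _)]mulmxA CC.
by rewrite [B^T *m B *m _]mulmxA mulmxV// mul1mx.
Qed.

(** The transpose of N S equals N S, so G^-1 (N S) = S G^-1 N^T, and both sides
become N S T G^-1 N^T. *)
Lemma gram_swap (G N S T : 'M[R]_n) : G \in unitmx ->
  S^T *m G = G *m S -> T^T *m G = G *m T -> S *m T = T *m S ->
  (N *m S)^T = N *m S -> (N *m T)^T = N *m T ->
  (N *m S)^T *m (invmx G *m (N *m T)) = (N *m T)^T *m (invmx G *m (N *m S)).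
Proof.
move=> uG GS GT ST NS NT.
have swap U : U^T *m G = G *m U -> (N *m U)^T = N *m U ->
    invmx G *m (N *m U) = U *m (invmx G *m N^T).
  by move=> GU <-; rewrite trmx_mul -[U^T](mulmxK uG) GU !mulmxA mulVmx// mul1mx.
rewrite NS NT !swap//.
by rewrite -!mulmxA [S *m (T *m _)]mulmxA ST -mulmxA.
Qed.

(** For N = G, the symmetry in gram_swap is equivalent to commutation. *)
Lemma gram_comm (G S T a b : 'M[R]_n) : G \in unitmx -> G^T = G ->
  S^T *m G = G *m S -> T^T *m G = G *m T -> a = G *m S -> b = G *m T ->
  a^T *m (invmx G *m b) = b^T *m (invmx G *m a) -> S *m T = T *m S.
Proof.
move=> uG trG GS GT -> ->; rewrite !mulKmx// !trmx_mul trG GS GT.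
by rewrite -!mulmxA => /(congr1 (mulmx (invmx G))); rewrite !mulKmx.
Qed.

(** A change of basis k transforms the metric, the cubic forms, and the
expressions in the Gauss equation compatibly. *)
Lemma gram_congr (q t k a b c e : 'M[R]_n) : q \in unitmx -> t \in unitmx ->
  t = k^T *m q *m k -> c = k^T *m a *m k -> e = k^T *m b *m k ->
  a^T *m (invmx q *m b) = b^T *m (invmx q *m a) ->
  c^T *m (invmx t *m e) = e^T *m (invmx t *m c).
Proof.
move=> uq ut tE -> -> swap.
have uk : k \in unitmx by move: ut; rewrite tE unitmx_mul => /andP[].
have kk : k *m invmx t *m k^T *m q = 1%:M.
  apply: (can_inj (mulmxK uk)); rewrite mul1mx -!mulmxA.
  by rewrite [k^T *m _]mulmxA -tE mulVmx// mulmx1.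
have {}kk : k *m invmx t *m k^T = invmx q by rewrite -[LHS](mulmxK uq) kk mul1mx.
have gram r s : (k^T *m r *m k)^T *m (invmx t *m (k^T *m s *m k))
    = k^T *m (r^T *m (invmx q *m s)) *m k.
  by rewrite -kk !trmx_mul trmxK !mulmxA.
by rewrite !gram swap.
Qed.

Variable O : set 'cV[R]_n.
Hypothesis oO : open O.

(** Obtained by differentiating the isotropy condition. Here B need not be
a Jacobian matrix; it is applied both to the differential of f and to the
rotated frame, which in general is not one. *)
Lemma lagrangian_cubic_sym (B : 'cV[R]_n -> 'M[R]_(n + n, n)) y X :
  (forall z, O z -> differentiable B z) ->
  (forall z, O z -> (B z)^T *m J *m B z = 0) -> O y ->
  ((J *m B y)^T *m 'D_X B y)^T = (J *m B y)^T *m 'D_X B y.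
Proof.
move=> dB BJB Oy; have dBy := dB _ Oy.
have dJB : differentiable (fun z => J *m B z) y.
  by apply: differentiable_mulmx => //; exact: differentiable_cst.
have : 'D_X (fun z => (B z)^T *m (J *m B z)) y = 0.
  rewrite -(derive_cst (0 : 'M[R]_n) y X).
  by apply: (derive_germ _ oO) => // z; rewrite inE => /BJB; rewrite -mulmxA.
rewrite (derive_mulmx X (differentiable_trmx dBy) dJB).
rewrite (derive_trmx X dBy) (derive_mulmxl J X dBy).
move: (B y) ('D_X B y) => b b' /eqP; rewrite addr_eq0 => /eqP h.
rewrite trmx_mul trmxK h trmx_mul tr_J mulmxN mulNmx.
by rewrite mulmxA.
Qed.

End LagrangianMaps.

Section LagrangianGauss.
Context {R : realType} {n : nat} {M : smooth_manifold R n}.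
Local Notation J := (@Jmx R n).
Variables (g : chart M -> M -> 'M[R]_n) (i : chart M) (O : set 'cV[R]_n).
Variable h : 'cV[R]_n -> 'cV[R]_(n + n).
Hypotheses (oO : open O) (Ochart : O `<=` Defs.coord i @` cdom i).
Hypothesis sh : smooth_on O h.
Let A := Jac h.
Let G y := (A y)^T *m A y.
Hypothesis gE : forall y, O y -> g i (param i y) = G y.
Hypothesis uG : forall y, O y -> G y \in unitmx.
Hypothesis AJA : forall y, O y -> (A y)^T *m J *m A y = 0.

(** The Gauss equation, with the second fundamental form expressed by the
cubic forms c X through lagrangian_normal_gram. *)
Lemma lagrangian_gauss y X Y Z (c := fun W => (J *m A y)^T *m 'D_W A y) : O y ->
  G y *m curvature g i (param i y) X Y Z =
  ((c X)^T *m (invmx (G y) *m c Y) - (c Y)^T *m (invmx (G y) *m c X)) *m Z.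
Proof.
move=> Oy; have gramE U W :=
  lagrangian_normal_gram ('D_U A y) ('D_W A y) (uG Oy) (AJA Oy).
apply: etrans (gauss_equation oO Ochart sh gE uG X Y Z Oy) _.
exact: (congr2 (fun p q => (p - q) *m Z) (gramE X Y) (gramE Y X)).
Qed.

End LagrangianGauss.

(** * P-transforms in Euclidean coordinates *)

Section PTransformInChart.
Context {R : realType} {n d : nat}.
Local Notation J := (@Jmx R n).
Variable U : set 'cV[R]_n.
Hypothesis oU : open U.
Variables (h : 'cV[R]_n -> 'cV[R]_(n + n)) (phi : 'cV[R]_n -> 'cV[R]_d).
Variables (Om : 'cV[R]_n -> 'M[R]_d) (P : 'M[R]_d).
Hypotheses (sh : smooth_on U h) (sphi : smooth_on U phi) (sOm : smooth_on U Om).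
Let A := Jac h.
Let G y := (A y)^T *m A y.
Let w := Jac phi.
Let W y := invmx (G y) *m (w y)^T.
Let F y := A y *m W y + J *m A y *m W y *m P.
(* E is A multiplied by 1 - F Om^-1 F^T, since F^T A = w. *)
Let E y := A y - F y *m (invmx (Om y) *m w y).
Let ft y := h y - F y *m invmx (Om y) *m phi y.
Let At := Jac ft.
(* The coefficients of At in the frame E. *)
Let K y := invmx (G y) *m ((E y)^T *m At y).
Let Q := invmx P.
(* S is the cubic form of h, and Gam is its connection matrix. *)
Let S X y := invmx (G y) *m ((J *m A y)^T *m 'D_X A y).
Let Gam X y := invmx (G y) *m ((A y)^T *m 'D_X A y).
Hypothesis uG : forall y, U y -> G y \in unitmx.
Hypothesis AJA : forall y, U y -> (A y)^T *m J *m A y = 0.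
Hypothesis uOm : forall y, U y -> Om y \in unitmx.
Hypothesis uP : P \in unitmx.
Hypothesis betaE : forall y X, U y ->
  (J *m A y)^T *m 'D_X A y *m W y
  + (A y)^T *m 'D_X (fun z => A z *m W z) y *m P = 0.
Hypothesis OmD : forall y X, U y -> 'D_X Om y = (F y)^T *m 'D_X F y.
Hypothesis OmS : forall y, U y -> Om y + (Om y)^T = (F y)^T *m F y.
Hypothesis OmP : forall y, U y ->
  let T := - P^T - invmx P^T in
  let rho := P^T *m w y *m W y *m P in
  (Om y)^T *m P + P^T *m (Om y)^T + T *m rho = 0.

Let sA : smooth_on U A. Proof. exact: smooth_on_Jac. Qed.
Let sw : smooth_on U w. Proof. exact: smooth_on_Jac. Qed.
Let sG : smooth_on U G.
Proof. apply: (smooth_on_mulmx oU) sA; exact: (smooth_on_trmx oU). Qed.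
Let sW : smooth_on U W.
Proof.
apply: (smooth_on_mulmx oU); first exact: (smooth_on_invmx oU).
exact: (smooth_on_trmx oU).
Qed.
Let sAW : smooth_on U (fun y => A y *m W y).
Proof. exact: (smooth_on_mulmx oU). Qed.

Let FE y : F y = A y *m W y + J *m (A y *m W y) *m P.
Proof. by rewrite /F !mulmxA. Qed.

Let sF : smooth_on U F.
Proof.
have -> : F = fun y => A y *m W y + J *m (A y *m W y) *m P by exact/funext.
apply: (smooth_on_add oU) => //; apply: (smooth_on_mulmx oU);
  last exact: smooth_on_cst.
by apply: (smooth_on_mulmx oU) => //; exact: smooth_on_cst.
Qed.
Let sOi : smooth_on U (fun y => invmx (Om y)).
Proof. exact: (smooth_on_invmx oU). Qed.
Let sE : smooth_on U E.
Proof.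
apply: (smooth_on_add oU) => //; apply: (smooth_on_opp oU).
by do 2!apply: (smooth_on_mulmx oU) => //.
Qed.
Lemma smooth_on_transform : smooth_on U ft.
Proof.
apply: (smooth_on_add oU) => //; apply: (smooth_on_opp oU).
by do 2!apply: (smooth_on_mulmx oU) => //.
Qed.
Let sAt : smooth_on U At. Proof. exact: (smooth_on_Jac oU smooth_on_transform). Qed.
Let sK : smooth_on U K.
Proof.
apply: (smooth_on_mulmx oU); first exact: (smooth_on_invmx oU).
by apply: (smooth_on_mulmx oU) => //; exact: (smooth_on_trmx oU).
Qed.

Let trG y : (G y)^T = G y. Proof. by rewrite trmx_mul trmxK. Qed.

Section AtPoint.
Variable y : 'cV[R]_n.
Hypothesis Uy : U y.

Let dA : differentiable A y. Proof. exact: smooth_on_differentiable sA Uy. Qed.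
Let dW : differentiable W y. Proof. exact: smooth_on_differentiable sW Uy. Qed.
Let dF : differentiable F y. Proof. exact: smooth_on_differentiable sF Uy. Qed.
Let dw : differentiable w y. Proof. exact: smooth_on_differentiable sw Uy. Qed.
Let dOm : differentiable Om y. Proof. exact: smooth_on_differentiable sOm Uy. Qed.
Let dOi : differentiable (fun y => invmx (Om y)) y.
Proof. exact: smooth_on_differentiable sOi Uy. Qed.
Let dAW : differentiable (fun y => A y *m W y) y.
Proof. exact: smooth_on_differentiable sAW Uy. Qed.

Let WG : (W y)^T *m G y = w y.
Proof. by rewrite trmx_mul trmxK trmx_inv trG mulmxKV// uG. Qed.

Lemma cubic_sym X : (S X y)^T *m G y = G y *m S X y.
Proof.
rewrite -[in LHS]trG -trmx_mul /S mulKVmx; last exact: uG.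
apply: (lagrangian_cubic_sym oU) => // z Uz.
exact: smooth_on_differentiable sA Uz.
Qed.

Let derive_A_W X :
  'D_X (fun z => A z *m W z) y = 'D_X A y *m W y + A y *m 'D_X W y.
Proof. exact: derive_mulmx. Qed.

Lemma derive_calF X : 'D_X F y = - (A y *m (S X y *m (W y *m (P + Q)))).
Proof.
have dJAW := differentiable_mulmx (differentiable_cst J y) dAW.
have dJAWP := differentiable_mulmx dJAW (differentiable_cst P y).
have -> : F = fun z => A z *m W z + J *m (A z *m W z) *m P by exact/funext.
apply: etrans (deriveD (diff_derivable dAW) (diff_derivable dJAWP)) _.
rewrite (derive_mulmxr P X dJAW) (derive_mulmxl J X dAW).
apply: (calF_variation (erefl (G y)) (AJA Uy)) (derive_A_W X) (betaE X Uy) => //.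
- by rewrite /S mulKVmx ?uG.
- exact: uG.
Qed.

Let AWA z : U z -> w z = (A z *m W z)^T *m A z.
Proof.
move=> Uz; rewrite trmx_mul -mulmxA -/(G z) trmx_mul trmxK trmx_inv trG.
by rewrite mulmxKV// uG.
Qed.

Lemma derive_omega X : 'D_X w y = w y *m Gam X y - Q^T *m (w y *m S X y).
Proof.
have dAWt := differentiable_trmx dAW.
transitivity ('D_X (fun z => (A z *m W z)^T *m A z) y).
  by apply: (derive_germ _ oU) => // z; rewrite inE; exact: AWA.
rewrite (derive_mulmx X dAWt dA) (derive_trmx X dAW).
apply: (omega_variation (erefl (G y)) (AJA Uy) WG uP _ _ (uG Uy) (derive_A_W X)
  (betaE X Uy)).
- by rewrite /S mulKVmx ?uG.
- by rewrite /Gam mulKVmx ?uG.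
- exact: cubic_sym.
Qed.

Let derive_Oi X : 'D_X (fun z => invmx (Om z)) y =
  - (invmx (Om y) *m ((F y)^T *m 'D_X F y) *m invmx (Om y)).
Proof. by rewrite (derive_invmx X (uOm Uy) dOm) OmD. Qed.

(** The coefficient of S X y in the last term does not depend on X; this is
what makes the cubic form of the rotated frame a multiple of the one of f. *)
Lemma derive_rotated_frame X : 'D_X E y =
  E y *m (Gam X y + S X y *m (W y *m ((P + Q) *m (invmx (Om y) *m w y)))) +
  (J *m A y + F y *m (invmx (Om y) *m (Q^T *m w y))) *m S X y.
Proof.
have dOiw := differentiable_mulmx dOi dw.
have dFOiw := differentiable_mulmx dF dOiw.
apply: etrans (deriveB (diff_derivable dA) (diff_derivable dFOiw)) _.
rewrite (derive_mulmx X dF dOiw) (derive_mulmx X dOi dw) derive_Oi derive_omega.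
rewrite derive_calF.
apply: (frame_variation (erefl (G y)) (AJA Uy) WG _ _ _ _ (uG Uy)) => //.
- by rewrite /S mulKVmx ?uG.
- by rewrite /Gam mulKVmx ?uG.
Qed.

Lemma derive_transform Y : 'D_Y ft y =
  E y *m (Y + S Y y *m (W y *m ((P + Q) *m (invmx (Om y) *m phi y)))).
Proof.
have dh : differentiable h y by exact: smooth_on_differentiable sh Uy.
have dphi : differentiable phi y by exact: smooth_on_differentiable sphi Uy.
have dFOi := differentiable_mulmx dF dOi.
have dFOip := differentiable_mulmx dFOi dphi.
apply: etrans (deriveB (diff_derivable dh) (diff_derivable dFOip)) _.
rewrite (derive_mulmx Y dFOi dphi) (derive_mulmx Y dF dOi) derive_Oi derive_calF.
rewrite -(mul_Jac Y dh) -(mul_Jac Y dphi).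
exact: (transform_variation (erefl (G y)) (AJA Uy) WG).
Qed.

Lemma rotated_frame_isometric : (E y)^T *m E y = G y.
Proof.
apply: (gram_rotated_frame (erefl (G y)) (AJA Uy) WG (erefl _) (uOm Uy)) => //.
exact: OmS.
Qed.

Lemma rotated_frame_isotropic : (E y)^T *m J *m E y = 0.
Proof.
apply: (isotropic_rotated_frame (erefl (G y)) (AJA Uy) WG (erefl _) (uOm Uy)) => //.
- exact: OmS.
- exact: OmP.
Qed.

(** By derive_transform the image of the differential of the transform lies
in the plane spanned by E; since E^T E = G, its coefficients are K. *)
Lemma Jac_transform : At y = E y *m K y.
Proof.
have uGE : (E y)^T *m E y \in unitmx by rewrite rotated_frame_isometric uG.
have dft : differentiable ft y.
  exact: smooth_on_differentiable smooth_on_transform Uy.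
have EK (v : 'cV[R]_n) : At y *m v = E y *m (K y *m v).
  rewrite /K -!mulmxA (mul_Jac v dft) derive_transform.
  by rewrite [(E y)^T *m _]mulmxA rotated_frame_isometric mulKmx ?uG.
apply/matrixP => a k; have /matrixP/(_ a ord0) := EK (delta_mx k ord0).
by rewrite [in RHS]mulmxA -!colE !mxE.
Qed.

Lemma gram_transform_unit : \rank (At y) = n -> (At y)^T *m At y \in unitmx.
Proof.
move=> rAt; have uK : K y \in unitmx.
  rewrite -row_full_unit -col_leq_rank -[X in (X <= _)%N]rAt Jac_transform.
  exact: mxrankM_maxr.
have := rotated_frame_isometric; have := Jac_transform; move: uK (uG Uy).
move: (K y) (E y) (G y) (At y) => k e q a uk uq -> eE.
by rewrite trmx_mul -mulmxA [e^T *m _]mulmxA eE !unitmx_mul unitmx_tr uk uq.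
Qed.

Lemma transform_isotropic : (At y)^T *m J *m At y = 0.
Proof.
rewrite Jac_transform trmx_mul -!mulmxA [J *m (E y *m _)]mulmxA [(E y)^T *m _]mulmxA.
by rewrite [(E y)^T *m _]mulmxA rotated_frame_isotropic mul0mx mulmx0.
Qed.

End AtPoint.

Hypothesis flatE : forall y X Y, U y ->
  let c Z := (J *m A y)^T *m 'D_Z A y in
  (c X)^T *m (invmx (G y) *m c Y) = (c Y)^T *m (invmx (G y) *m c X).

(** The Gauss equation of a flat Lagrangian map. *)
Lemma cubic_comm y X Y : U y -> S X y *m S Y y = S Y y *m S X y.
Proof.
move=> Uy; have cE Z : (J *m A y)^T *m 'D_Z A y = G y *m S Z y.
  by rewrite /S mulKVmx ?uG.
exact: (gram_comm (uG Uy) (trG y) (cubic_sym Uy X) (cubic_sym Uy Y)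
  (cE X) (cE Y) (flatE X Y Uy)).
Qed.

(** The cubic form of E is N S_X with a fixed matrix N. *)
Lemma rotated_frame_gauss_sym y X Y (c := fun Z => (J *m E y)^T *m 'D_Z E y) : U y ->
  (c X)^T *m (invmx (G y) *m c Y) = (c Y)^T *m (invmx (G y) *m c X).
Proof.
move=> Uy.
pose N := (J *m E y)^T *m (J *m A y + F y *m (invmx (Om y) *m (Q^T *m w y))).
have JEE : (J *m E y)^T *m E y = 0.
  by rewrite trmx_mul tr_J mulmxN mulNmx rotated_frame_isotropic// oppr0.
have cE Z : c Z = N *m S Z y.
  by rewrite /c (derive_rotated_frame Uy) mulmxDr mulmxA JEE mul0mx add0r mulmxA.
have dE z : U z -> differentiable E z.
  by move=> Uz; exact: smooth_on_differentiable sE Uz.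
have cS Z : (N *m S Z y)^T = N *m S Z y.
  rewrite -cE.
  exact: (@lagrangian_cubic_sym _ _ _ oU _ _ Z dE rotated_frame_isotropic Uy).
rewrite (cE X) (cE Y).
exact: (gram_swap (uG Uy) (cubic_sym Uy X) (cubic_sym Uy Y)
  (cubic_comm X Y Uy) (cS X) (cS Y)).
Qed.

(** The differential of the transform is E K. Differentiating K contributes
only tangential terms, so the cubic forms of the transform are those of E in
the basis changed by K. *)
Lemma transform_gauss_sym y X Y (c := fun Z => (J *m At y)^T *m 'D_Z At y) : U y ->
  (At y)^T *m At y \in unitmx ->
  (c X)^T *m (invmx ((At y)^T *m At y) *m c Y) =
  (c Y)^T *m (invmx ((At y)^T *m At y) *m c X).
Proof.
move=> Uy; have gramE : (At y)^T *m At y = (K y)^T *m G y *m K y.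
  have := rotated_frame_isometric Uy; have := Jac_transform Uy.
  move: (K y) (E y) (G y) (At y) => k e q a -> <-.
  by rewrite trmx_mul !mulmxA.
move=> uGt.
have dE : differentiable E y by exact: smooth_on_differentiable sE Uy.
have dK : differentiable K y by exact: smooth_on_differentiable sK Uy.
have dAt Z : 'D_Z At y = 'D_Z E y *m K y + E y *m 'D_Z K y.
  rewrite -(derive_mulmx Z dE dK).
  have AtE : {in U, At =1 (fun z => E z *m K z)}.
    by move=> z; rewrite inE; exact: Jac_transform.
  exact: (derive_germ Z oU AtE Uy).
have JEE : (J *m E y)^T *m E y = 0.
  by rewrite trmx_mul tr_J mulmxN mulNmx rotated_frame_isotropic// oppr0.
have cE Z : c Z = (K y)^T *m ((J *m E y)^T *m 'D_Z E y) *m K y.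
  rewrite /c dAt (Jac_transform Uy); move: JEE.
  move: (K y) (E y) ('D_Z E y) ('D_Z K y) => k e e' k' JEE.
  rewrite [J *m _]mulmxA trmx_mul mulmxDr !mulmxA.
  by rewrite -[_ *m _ *m e]mulmxA JEE mulmx0 mul0mx addr0.
exact: (gram_congr (uG Uy) uGt gramE (cE X) (cE Y) (rotated_frame_gauss_sym X Y Uy)).
Qed.

End PTransformInChart.

(** * P-transforms on a manifold, read in a chart *)

Section InChart.
Context {R : realType} {n : nat} {M : smooth_manifold R n}.
Local Notation J := (@Jmx R n).

Lemma bilinear_inj p q (B C : 'M[R]_(p, q)) :
  (forall (X : 'cV[R]_p) (Y : 'cV[R]_q),
    (X^T *m B *m Y) ord0 ord0 = (X^T *m C *m Y) ord0 ord0) -> B = C.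
Proof.
move=> BC; apply/matrixP => k l; have := BC (delta_mx k ord0) (delta_mx l ord0).
by rewrite !trmx_delta -!rowE -!colE !mxE.
Qed.

Variables (g : chart M -> M -> 'M[R]_n) (f : M -> 'cV[R]_(n + n)).
Hypotheses (hg : riemannian_metric g) (hf : isometric_immersion f g).
Hypothesis (hL : lagrangian_on setT f).
Variable i : chart M.
Let U : set 'cV[R]_n := Defs.coord i @` cdom i.
Let oU : open U. Proof. exact: cimg_open. Qed.
Let fU := f \o param i.
Let A := Jac fU.
Let G y := (A y)^T *m A y.

Let sf : smooth_on U fU. Proof. by have [sf _ _] := hf; exact: sf. Qed.

Lemma ddE m (F : M -> 'cV[R]_m) y X : U y -> differentiable (F \o param i) y ->
  dd i F (param i y) X = Jac (F \o param i) y *m X.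
Proof.
move=> Uy dF; rewrite /dd coord_param// (mul_Jac X dF)//.
Qed.

Let dd_f y X : U y -> dd i f (param i y) X = A y *m X.
Proof. by move=> Uy; apply: ddE => //; exact: smooth_on_differentiable sf Uy. Qed.

Lemma metric_gram y : U y -> g i (param i y) = G y.
Proof.
move=> Uy; apply: bilinear_inj => X Y; have [_ _ iso] := hf.
have := iso _ _ X Y (cdom_param Uy); rewrite !dd_f// /Defs.form => <-.
by rewrite /dot trmx_mul !mulmxA.
Qed.

Lemma gram_unit y : U y -> G y \in unitmx.
Proof.
move=> Uy; rewrite -metric_gram// -row_free_unit -kermx_eq0.
apply/rowV0P => v /sub_kermxP vg; apply/eqP; apply/negPn/negP => v0.
have := metric_pos hg (cdom_param Uy) (X := v^T).
rewrite trmx_eq0 => /(_ v0); rewrite /Defs.form trmxK vg mul0mx mxE ltxx //.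
Qed.

Lemma lagrangian_isotropic y : U y -> (A y)^T *m J *m A y = 0.
Proof.
move=> Uy; apply: bilinear_inj => X Y.
have /seteqP[sub _] := hL (cdom_param Uy) I.
have := sub (J *m (A y *m Y)).
move=> /(_ (ex_intro2 _ _ (A y *m Y) _ (erefl _))).
have tan Z : tangent_space f i (param i y) (A y *m Z).
  by exists Z => //; rewrite dd_f.
move=> /(_ (tan Y))/(_ _ (tan X)); rewrite /dot trmx_mul => h.
by rewrite mulmx0 mul0mx [RHS]mxE -h !mulmxA.
Qed.

Lemma flat_gauss_sym y X Y : flat_on g setT -> U y ->
  let c Z := (J *m A y)^T *m 'D_Z A y in
  (c X)^T *m (invmx (G y) *m c Y) = (c Y)^T *m (invmx (G y) *m c X).
Proof.
move=> flat Uy c; apply/eqP; rewrite -subr_eq0; apply/eqP.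
apply/matrixP => k l; rewrite [RHS]mxE.
have := lagrangian_gauss oU (@subset_refl _ _) sf metric_gram gram_unit
  lagrangian_isotropic X Y (delta_mx l ord0) Uy.
rewrite (flat i (param i y) X Y (delta_mx l ord0) (cdom_param Uy) I) mulmx0.
by move/matrixP/(_ k ord0); rewrite -colE !mxE => <-.
Qed.

Variables (d : nat) (phi : M -> 'cV[R]_d) (beta : M -> 'M[R]_(n + n, d)).
Variables (Omega : M -> 'M[R]_d) (P : 'M[R]_d) (ft : M -> 'cV[R]_(n + n)).
Hypothesis hP : P_transform g f phi beta Omega P ft.
Let hR := pt_ribaucour hP.
Let phiU := phi \o param i.
Let OmU := Omega \o param i.
Let w := Jac phiU.
Let W y := invmx (G y) *m (w y)^T.
Let F y := A y *m W y + J *m A y *m W y *m P.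

Let sphi : smooth_on U phiU. Proof. exact: vr_phi_smooth hR i. Qed.
Let sOm : smooth_on U OmU. Proof. exact: vr_Omega_smooth hR i. Qed.

(** Zero is its own opposite, so it cannot lie in the spectrum of P. *)
Lemma P_unit : P \in unitmx.
Proof.
rewrite -unitmx_tr -row_free_unit -kermx_eq0; apply/rowV0P => v.
move=> /sub_kermxP vP; apply/eqP/negPn/negP => v0.
have sp0 : spectrum P 0.
  apply/eigenvalueP; exists (map_mx (real_complex R) v).
    by rewrite map_trmx -map_mxM vP map_mx0 scale0r.
  by rewrite map_mx_eq0.
have /seteqP[/(_ 0) no _] := pt_spectrum hP.
by apply: no; split => //; exists 0 => //; rewrite oppr0.
Qed.

Let omegaE y : U y -> omega phi i (param i y) = w y.
Proof. by move=> Uy; rewrite /omega /diff_mx /dd coord_param. Qed.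

Let omega_tE y : U y -> omega_t g phi i (param i y) = W y.
Proof. by move=> Uy; rewrite /omega_t omegaE// metric_gram. Qed.

Let diff_f y : U y -> diff_mx i f (param i y) = A y.
Proof. by move=> Uy; rewrite /diff_mx /dd coord_param. Qed.

Let betaE y : U y -> beta (param i y) = J *m A y *m W y *m P.
Proof.
move=> Uy; apply: etrans (pt_beta hP (cdom_param Uy)) _.
exact: (congr2 (fun a b => J *m a *m b *m P) (diff_f Uy) (omega_tE Uy)).
Qed.

Let calFE y : U y -> calF g f phi beta i (param i y) = F y.
Proof.
move=> Uy; have AW := congr2 (@mulmx _ _ _ _) (diff_f Uy) (omega_tE Uy).
exact: (congr2 +%R AW (betaE Uy)).
Qed.

Let normal_partE y (v : 'cV[R]_(n + n)) : U y ->
  (J *m A y)^T *m normal_part f i (param i y) v = (J *m A y)^T *m v.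
Proof.
move=> Uy; rewrite /normal_part diff_f// mulmxBr !mulmxA.
have -> : (J *m A y)^T *m A y = 0.
  by rewrite trmx_mul tr_J mulmxN mulNmx lagrangian_isotropic// oppr0.
by rewrite !mul0mx subr0.
Qed.

Let sA : smooth_on U A. Proof. exact: smooth_on_Jac. Qed.

Let sAW : smooth_on U (fun z => A z *m W z).
Proof.
apply: (smooth_on_mulmx oU) => //; apply: (smooth_on_mulmx oU).
  apply: (smooth_on_invmx oU); first exact: gram_unit.
  by apply: (smooth_on_mulmx oU) => //; exact: (smooth_on_trmx oU).
by apply: (smooth_on_trmx oU); exact: smooth_on_Jac.
Qed.

(** The equation for alpha and beta, with its values read off along J A, where the
normal projections disappear. *)
Let beta_equation y X : U y ->
  (J *m A y)^T *m 'D_X A y *m W y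
  + (A y)^T *m 'D_X (fun z => A z *m W z) y *m P = 0.
Proof.
move=> Uy; apply: bilinear_inj => V Y.
have dA : differentiable A y by exact: smooth_on_differentiable sA Uy.
have dAW := smooth_on_differentiable sAW Uy.
have dJAW := differentiable_mulmx (differentiable_cst J y) dAW.
have second : second_form f i (param i y) X (W y *m Y) =
    normal_part f i (param i y) ('D_X A y *m (W y *m Y)).
  congr (normal_part _ _ _ _); rewrite -(derive_mulmxr (W y *m Y) X dA).
  apply: (dd_germ oU (@subset_refl _ U) (F := fun p => dd i f p (W y *m Y))
    (F' := fun z => A z *m (W y *m Y)) X _ Uy) => z Uz; exact: dd_f.
have nabla : nabla_beta f beta i (param i y) X Y =
    normal_part f i (param i y) (J *m 'D_X (fun z => A z *m W z) y *m (P *m Y)).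
  congr (normal_part _ _ _ _); rewrite -(derive_mulmxl J X dAW).
  rewrite -(derive_mulmxr (P *m Y) X dJAW).
  apply: (dd_germ oU (@subset_refl _ U) (F := fun p => beta p *m Y)
    (F' := fun z => J *m (A z *m W z) *m (P *m Y)) X _ Uy) => z Uz.
  by rewrite betaE// !mulmxA.
have := vr_beta_eq hR X Y (cdom_param Uy); rewrite omega_tE// second nabla.
move=> /(congr1 (mulmx (J *m A y)^T)) h.
rewrite mulmxDr !(normal_partE _ Uy) mulmx0 in h.
have -> : (V^T *m (0 : 'M[R]_(n, d)) *m Y) ord0 ord0 = 0.
  by rewrite mulmx0 mul0mx mxE.
have -> : (J *m A y)^T *m 'D_X A y *m W y +
    (A y)^T *m 'D_X (fun z => A z *m W z) y *m P =
    (J *m A y)^T *m ('D_X A y *m W y) +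
    (J *m A y)^T *m (J *m 'D_X (fun z => A z *m W z) y *m P).
  rewrite -!mulmxA; congr (_ + _).
  by rewrite trmx_mul tr_J mulmxN mulNmx -mulmxA mulJJ mulmxN opprK.
move: h.
move: ('D_X A y) ('D_X (fun z => A z *m W z) y) (J *m A y)^T => a b c h.
have -> : V^T *m (c *m (a *m W y) + c *m (J *m b *m P)) *m Y =
    V^T *m (c *m (a *m (W y *m Y)) + c *m (J *m b *m (P *m Y))).
  by rewrite -mulmxA mulmxDl !mulmxA.
by rewrite h mulmx0 mxE.
Qed.

Let Omega_derive y X : U y -> 'D_X OmU y = (F y)^T *m 'D_X F y.
Proof.
move=> Uy; have dOm : dd i Omega (param i y) X = 'D_X OmU y.
  by rewrite /dd coord_param.
have dF := dd_germ oU (@subset_refl _ U) (F := calF g f phi beta i) (F' := F)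
  X calFE Uy.
apply: etrans (esym dOm) _; apply: etrans (vr_Omega_diff hR X (cdom_param Uy)) _.
exact: (congr2 (fun a b => a^T *m b) (calFE Uy) dF).
Qed.

Let Omega_sum y : U y -> OmU y + (OmU y)^T = (F y)^T *m F y.
Proof.
move=> Uy; apply: etrans (vr_Omega_sym hR (cdom_param Uy)) _.
exact: (congr1 (fun a => a^T *m a) (calFE Uy)).
Qed.

Let Omega_P y : U y ->
  let T := - P^T - invmx P^T in
  let rho := P^T *m w y *m W y *m P in
  (OmU y)^T *m P + P^T *m (OmU y)^T + T *m rho = 0.
Proof.
move=> Uy; apply: etrans _ (pt_Omega hP (cdom_param Uy)).
exact: (congr2 (fun a b => (OmU y)^T *m P + P^T *m (OmU y)^T +
  (- P^T - invmx P^T) *m (P^T *m a *m b *m P)) (esym (omegaE Uy)) (esym (omega_tE Uy))).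
Qed.

Let Omega_unit y : U y -> OmU y \in unitmx.
Proof. by move=> _; exact: vr_Omega_unit hR _. Qed.

Let ftU y := fU y - F y *m invmx (OmU y) *m phiU y.

Let ftE y : U y -> ft (param i y) = ftU y.
Proof.
move=> Uy; apply: etrans (vr_transform hR (cdom_param Uy)) _.
exact: (congr1 (fun a => fU y - a *m invmx (OmU y) *m phiU y) (calFE Uy)).
Qed.

Let sftU : smooth_on U ftU.
Proof. exact: (smooth_on_transform oU P sf sphi sOm gram_unit Omega_unit). Qed.

Let dd_ft y X : U y -> dd i ft (param i y) X = Jac ftU y *m X.
Proof.
move=> Uy; have dft := smooth_on_differentiable sftU Uy.
exact: etrans (dd_germ oU (@subset_refl _ U) X ftE Uy) (esym (mul_Jac X dft)).
Qed.

Let diff_ft y : U y -> diff_mx i ft (param i y) = Jac ftU y.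
Proof.
move=> Uy; apply/matrixP => a k; rewrite !mxE.
exact: (congr1 (fun v : 'cV[R]_(n + n) => v a ord0)
  (dd_germ oU (@subset_refl _ U) (e_ k) ftE Uy)).
Qed.

Let ft_isotropic y : U y -> (Jac ftU y)^T *m J *m Jac ftU y = 0.
Proof.
move=> Uy.
exact: (transform_isotropic oU sf sphi sOm gram_unit lagrangian_isotropic
  Omega_unit P_unit beta_equation Omega_derive Omega_sum Omega_P Uy).
Qed.

Let ft_regular x : regular_points ft x -> cdom i x ->
  (Jac ftU (Defs.coord i x))^T *m Jac ftU (Defs.coord i x) \in unitmx.
Proof.
move=> reg xi; have Uy : U (Defs.coord i x) by exists x.
apply: (gram_transform_unit oU sf sphi sOm gram_unit lagrangian_isotropic
  Omega_unit P_unit beta_equation Omega_derive Omega_sum Uy).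
by rewrite -diff_ft// coordK//; exact: reg.
Qed.

Lemma P_transform_lagrangian x : cdom i x -> regular_points ft x ->
  [set J *m v | v in tangent_space ft i x] = Defs.normal_space ft i x.
Proof.
move=> xi reg; have uG := ft_regular reg xi.
pose y := Defs.coord i x; have Uy : U y by exists x.
have xE : x = param i y by rewrite coordK.
have isoy := ft_isotropic Uy.
rewrite xE; apply/seteqP; split=> [v /= [_ [Y _ <-] <-] _ [X _ <-]|v normal].
  rewrite !dd_ft// /dot trmx_mul -!mulmxA [(Jac ftU y)^T *m _]mulmxA.
  by rewrite [_ *m (_ *m Y)]mulmxA isoy mul0mx mulmx0 mxE.
have Av : (Jac ftU y)^T *m v = 0.
  apply: bilinear_inj => X Y; rewrite mulmx0 mul0mx [RHS]mxE.
  have -> : X^T *m ((Jac ftU y)^T *m v) *m Y = (Jac ftU y *m X)^T *m v *m Y.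
    by rewrite trmx_mul !mulmxA.
  have := normal _ (ex_intro2 _ _ X I (dd_ft X Uy)); rewrite /dot => h.
  by rewrite [_ *m v]mx11_scalar h mul_scalar_mx scale0r mxE.
have frame := lagrangian_frame uG isoy.
(* The coefficients of v in the frame given by the transform and its image under J. *)
exists (Jac ftU y *m (invmx ((Jac ftU y)^T *m Jac ftU y) *m ((J *m Jac ftU y)^T *m v))).
  by eexists; [|exact: dd_ft].
by rewrite -[RHS]mul1mx -frame mulmxDl -!mulmxA Av !mulmx0 add0r.
Qed.

(** The Gauss equation is used on the open set of those points of the chart
at which the transform is an immersion. *)
Lemma P_transform_flat x X Y Z : flat_on g setT -> cdom i x ->
  regular_points ft x -> curvature (induced_metric ft) i x X Y Z = 0.
Proof.
move=> flat xi reg; have uG := ft_regular reg xi.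
pose y := Defs.coord i x; have Uy : U y by exists x.
pose O := [set z | U z /\ (Jac ftU z)^T *m Jac ftU z \in unitmx].
have oO : open O.
  rewrite openE => z [Uz uz]; apply: filterI; first exact: open_nbhs_nbhs.
  have dJ := smooth_on_differentiable (smooth_on_Jac oU sftU) Uz.
  exact: (near_unitmx (A := fun z => (Jac ftU z)^T *m Jac ftU z) uz
    (differentiable_mulmx (differentiable_trmx dJ) dJ)).
have OU : O `<=` U by move=> z [].
have Oy : O y by split.
have sO := smooth_on_sub OU sftU.
have gE z : O z -> induced_metric ft i (param i z) = (Jac ftU z)^T *m Jac ftU z.
  by move=> [Uz _]; rewrite /induced_metric diff_ft.
have isoO z : O z -> (Jac ftU z)^T *m J *m Jac ftU z = 0.
  by move=> [Uz _]; exact: ft_isotropic.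
have uO z : O z -> (Jac ftU z)^T *m Jac ftU z \in unitmx by case.
have swap := transform_gauss_sym oU sf sphi sOm gram_unit lagrangian_isotropic
  Omega_unit P_unit beta_equation Omega_derive Omega_sum Omega_P
  (fun y X Y => @flat_gauss_sym y X Y flat) X Y Uy uG.
have gauss := lagrangian_gauss oO OU sO gE uO isoO X Y Z Oy.
have cancel (q p r : 'M[R]_n) (v : 'cV[R]_n) : q \in unitmx -> p = r ->
    q *m v = (p - r) *m Z -> v = 0.
  by move=> uq -> qv; rewrite -[v](mulKmx uq) qv subrr mul0mx mulmx0.
have -> : x = param i y by rewrite coordK.
exact: cancel uG swap gauss.
Qed.

End InChart.

(** * The theorem *)

Theorem theorem44 (R : realType) (n : nat) (M : smooth_manifold R n)
    (g : chart M -> M -> 'M[R]_n) (f : M -> 'cV[R]_(n + n))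
    (hg : riemannian_metric g) (hflat : flat_on g setT)
    (hf : isometric_immersion f g) (hL : lagrangian_on setT f)
    (hnu : forall i x, cdom i x -> relative_nullity f i x = 0%N)
    (d : nat) (phi : M -> 'cV[R]_d) (beta : M -> 'M[R]_(n + n, d))
    (Omega : M -> 'M[R]_d) (P : 'M[R]_d) (ft : M -> 'cV[R]_(n + n))
    (hP : P_transform g f phi beta Omega P ft) :
  lagrangian_on (regular_points ft) ft /\
  flat_on (induced_metric ft) (regular_points ft).
Proof.
split=> [i x xi reg|i x X Y Z xi reg].
  exact: (P_transform_lagrangian hg hf hL hP xi reg).
exact: (P_transform_flat hg hf hL hP X Y Z hflat xi reg).
Qed.
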